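(* For every integer $r\ge 2$ and every real $\varepsilon>0$ there exist constants $c,C>0$, depending only on $r$ and $\varepsilon$, such that the following holds for all integers $n\ge 1$ and all $p\in(0,1]$. Let $X=X_{r,n,p}$ be the number of copies of $K_{1,r}$ in $G_{n,p}$ and $\mu:=\mathbb{E}X$. If $1\le (1+\varepsilon)\mu\le X_{r,n,1}$, then $$c\,\Phi\ \le\ -\log \mathbb{P}\bigl(X\ge (1+\varepsilon)\mu\bigr)\ \le\ C\,\Phi,\qquad\text{where}\quad \Phi:=\min\Bigl\{\mu,\ \max\bigl\{\mu^{1/r},\ \mu/n^{r-1}\bigr\}\log(1/p)\Bigr\}.$$
   Context: $G_{n,p}$ is the binomial random graph on the vertex set $\{1,\dots,n\}$, in which each of the $\binom n2$ possible edges is present independently with probability $p$. $K_{1,r}$ is the star with $r$ edges ($r$-armed star). A copy of $K_{1,r}$ in a graph is a (not necessarily induced) subgraph isomorphic to $K_{1,r}$. $X_{r,n,1}$ is the (deterministic) number of copies of $K_{1,r}$ in the complete graph $K_n$, i.e. $n\binom{n-1}{r}$ for $r\ge2$. $\log$ is the natural logarithm. *)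

(* Defs.v *)
From HB Require Import structures.
From mathcomp Require Import all_boot all_order all_algebra.
From mathcomp Require Import reals exp.

Set Implicit Arguments.
Unset Strict Implicit.
Unset Printing Implicit Defensive.

Import Order.TTheory GRing.Theory Num.Theory.
Local Open Scope ring_scope.

(* A simple graph on the vertex set T is represented by its edge set, a set of
   2-element subsets of T; the vertex set {1, ..., n} is represented by 'I_n. *)
Definition complete_graph (T : finType) : {set {set T}} :=
  [set e : {set T} | #|e| == 2].

(* K_{1,r}: centre ord0, leaves 1, ..., r. *)
Definition star (r : nat) : {set {set 'I_r.+1}} :=
  [set [set ord0; lift ord0 i] | i : 'I_r].

(* f is an isomorphism from the graph (S, H) onto the graph with vertex set F.1
   and edge set F.2. *)
Definition graph_iso (S T : finType) (H : {set {set S}})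
    (F : {set T} * {set {set T}}) (f : {ffun S -> T}) : bool :=
  [&& injectiveb f, f @: [set: S] == F.1
    & [set f @: (e : {set S}) | e in H] == F.2].

(* Copies are subgraphs (vertex set, edge set), so each one is counted once,
   irrespective of the automorphisms of H. *)
Definition copies (S T : finType) (H : {set {set S}}) (G : {set {set T}}) :
    {set {set T} * {set {set T}}} :=
  [set F : {set T} * {set {set T}} |
    (F.2 \subset G) && [exists f : {ffun S -> T}, graph_iso H F f]].

Definition star_count (r n : nat) (G : {set {set 'I_n}}) : nat :=
  #|copies (star r) G|.

Section BinomialRandomGraph.
Variables (R : realType) (n : nat) (p : R).

Definition gnp_mass (G : {set {set 'I_n}}) : R :=
  \prod_(e in complete_graph 'I_n) (if e \in G then p else 1 - p).

Definition gnp_prob (A : pred {set {set 'I_n}}) : R :=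
  \sum_(G : {set {set 'I_n}} | (G \subset complete_graph 'I_n) && A G)
     gnp_mass G.

Definition gnp_expect (X : {set {set 'I_n}} -> R) : R :=
  \sum_(G : {set {set 'I_n}} | G \subset complete_graph 'I_n)
     gnp_mass G * X G.

End BinomialRandomGraph.

Definition star_mean (R : realType) (r n : nat) (p : R) : R :=
  gnp_expect p (fun G : {set {set 'I_n}} => (star_count r G)%:R).

Definition upper_tail_rate (R : realType) (r n : nat) (p : R) : R :=
  let mu := star_mean r n p in
  Num.min mu
    (Num.max (mu `^ (r%:R^-1)) (mu / n%:R ^+ r.-1) * ln (p^-1)).

(* Main.v *)
(* Write X = sum_v C(d_v, r), mu = E X, m = (n - r) p, l = ln(1/p) and
   M = max(mu^(1/r), mu / n^(r-1)).

   Upper bound on the probability. Let L = min(n, K mu^(1/r)). A union bound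
   shows that degrees above L are as unlikely as exp(- c M l). For the stars at
   vertices of degree at most L we bound the moment generating function at
   lam = delta min(1, l / L^(r-1)), for which lam mu >= c min(mu, M l). Each edge
   meets only two vertices, so Finner's inequality bounds
   E prod_v exp(lam f(d_v)) by prod_v sqrt(E exp(2 lam f(d_v))), as if the degrees
   were independent. Size biasing the binomial law by C(., r) reduces what is
   left to an exponential moment of a shifted binomial variable, where the
   Chernoff bound beats 2 lam C(d, r) for all d <= L. The factor 2 of the final
   union bound is absorbed with Markov's inequality P <= 1 / (1 + eps).

   Lower bound. Planting one star of size O(mu^(1/r)), or O(mu / n^r) vertices of
   full degree, costs at most exp(- C M l). If mu = o(n) then, with
   probability at least exp(- C mu), exactly t vertices of the first half have at
   least r edges assigned to them, where t = O(mu) is at least (1 + eps) mu and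
   the edges are assigned to single endpoints to get independence. Otherwise
   M l = O(mu), and planting suffices. *)

Require Import Defs.
From HB Require Import structures.
From mathcomp Require Import all_boot all_order all_algebra.
From mathcomp Require Import ring lra zify.
From mathcomp Require Import reals sequences exp.

Set Implicit Arguments.
Unset Strict Implicit.
Unset Printing Implicit Defensive.

Import Order.TTheory GRing.Theory Num.Theory.
Local Open Scope ring_scope.

(** * Binomial and random-subset expectations *)

(** The expectation of h(Bin(k, p)), encoded by averaging over one trial at a time, so that its
    identities follow by induction on k without binomial sums. *)
Fixpoint bin_mean (R : realType) (p : R) (k : nat) (h : nat -> R) : R :=
  if k is k'.+1 then bin_mean p k' (fun j => (1 - p) * h j + p * h j.+1)
  else h 0.

Lemma eq_bin_mean (R : realType) (p : R) k (h1 h2 : nat -> R) :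
  h1 =1 h2 -> bin_mean p k h1 = bin_mean p k h2.
Proof.
by elim: k h1 h2 => [|k IH] h1 h2 eqh //=; apply: IH => j; rewrite !eqh.
Qed.

Lemma bin_meanD (R : realType) (p : R) k (h1 h2 : nat -> R) :
  bin_mean p k (fun j => h1 j + h2 j) = bin_mean p k h1 + bin_mean p k h2.
Proof.
elim: k h1 h2 => [|k IH] h1 h2 //=; rewrite -IH.
by apply: eq_bin_mean => j; ring.
Qed.

Lemma bin_meanZ (R : realType) (p : R) k c (h : nat -> R) :
  bin_mean p k (fun j => c * h j) = c * bin_mean p k h.
Proof.
elim: k h => [|k IH] h //=; rewrite -IH.
by apply: eq_bin_mean => j; ring.
Qed.

Lemma bin_mean_cst (R : realType) (p : R) k c : bin_mean p k (fun=> c) = c.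
Proof.
by elim: k => [|k IH] //=; rewrite -[RHS]IH; apply: eq_bin_mean => j; ring.
Qed.

Lemma bin_mean_sum (R : realType) (p : R) k (I : Type) (s : seq I) c
    (h : I -> nat -> R) :
  bin_mean p k (fun j => \sum_(i <- s) c i * h i j) =
  \sum_(i <- s) c i * bin_mean p k (h i).
Proof.
elim: s => [|i s IH].
  rewrite big_nil -[RHS](bin_mean_cst p k 0).
  by apply: eq_bin_mean => j; rewrite big_nil.
rewrite big_cons -IH -bin_meanZ -bin_meanD.
by apply: eq_bin_mean => j; rewrite big_cons.
Qed.

Lemma bin_mean_le (R : realType) (p : R) k (h1 h2 : nat -> R) :
  0 <= p -> p <= 1 -> (forall j, (j <= k)%N -> h1 j <= h2 j) ->
  bin_mean p k h1 <= bin_mean p k h2.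
Proof.
move=> p0 p1; elim: k h1 h2 => [|k IH] h1 h2 le12 /=; first exact: le12.
apply: IH => j jk; apply: lerD; apply: ler_wpM2l => //.
- by rewrite subr_ge0.
- by apply: le12; rewrite leqW.
- exact: le12.
Qed.

Lemma bin_mean_ge0 (R : realType) (p : R) k (h : nat -> R) :
  0 <= p -> p <= 1 -> (forall j, 0 <= h j) -> 0 <= bin_mean p k h.
Proof.
by move=> p0 p1 h0; rewrite -[X in X <= _](bin_mean_cst p k 0) bin_mean_le.
Qed.

Lemma bin_mean_exp (R : realType) (p : R) k (s : R) :
  bin_mean p k (fun j => s ^+ j) = (1 - p + p * s) ^+ k.
Proof.
elim: k => [|k IH] //=; rewrite exprS -IH -bin_meanZ.
by apply: eq_bin_mean => j; rewrite exprS; ring.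
Qed.

Lemma bin_mean_eq0 (R : realType) (p : R) k :
  bin_mean p k (fun j => (j == 0)%:R) = (1 - p) ^+ k.
Proof.
rewrite -[1 - p]addr0 -(mulr0 p) -bin_mean_exp.
by apply: eq_bin_mean => j; rewrite expr0n.
Qed.

(** Marking one success fixes that trial and leaves k - 1 random ones; iterating this gives size
    biasing by C(., r). *)
Lemma bin_mean_idM (R : realType) (p : R) k (h : nat -> R) :
  bin_mean p k (fun j => j%:R * h j) =
  k%:R * p * bin_mean p k.-1 (fun j => h j.+1).
Proof.
elim: k h => [|k IH] h /=; first by rewrite !mul0r.
transitivity (bin_mean p k (fun j => j%:R * ((1 - p) * h j + p * h j.+1)
                                     + p * h j.+1)).
  by apply: eq_bin_mean => j; rewrite -natr1; ring.
rewrite bin_meanD IH bin_meanZ; case: k {IH} => [|k] /=; first by ring.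
by rewrite -[k.+2%:R]natr1; ring.
Qed.

(* Size biasing: weighting Bin(k, p) by C(., r) gives r + Bin(k - r, p). *)
Lemma bin_mean_binM (R : realType) (p : R) r k (h : nat -> R) :
  bin_mean p k (fun j => 'C(j, r)%:R * h j) =
  'C(k, r)%:R * p ^+ r * bin_mean p (k - r) (fun j => h (j + r)%N).
Proof.
elim: r k h => [|r IH] k h.
  rewrite bin0 expr0 mulr1 mul1r subn0; apply: eq_bin_mean => j.
  by rewrite bin0 mul1r addn0.
(* The factor r + 1 makes the absorption identity (r + 1) C(j, r + 1) = j C(j - 1, r) available. *)
apply: (@mulfI _ r.+1%:R); first by rewrite pnatr_eq0.
rewrite -[LHS]bin_meanZ.
transitivity (bin_mean p k (fun j => j%:R * ('C(j.-1, r)%:R * h j))).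
  apply: eq_bin_mean => j; rewrite !mulrA -!natrM.
  by case: j => [|j]; rewrite ?bin0n ?muln0 ?mul0n // -mul_bin_diag.
rewrite bin_mean_idM IH exprS.
have -> : (k.-1 - r = k - r.+1)%N by rewrite -subn1 -subnDA add1n.
have -> : bin_mean p (k - r.+1) (fun j => h (j + r).+1) =
          bin_mean p (k - r.+1) (fun j => h (j + r.+1)%N).
  by apply: eq_bin_mean => j; rewrite addnS.
have : k%:R * 'C(k.-1, r)%:R = r.+1%:R * 'C(k, r.+1)%:R :> R.
  by rewrite -!natrM mul_bin_diag.
move=> eqC; rewrite -[LHS]mulr1; set B := bin_mean _ _ _.
transitivity (p * p ^+ r * B * (k%:R * 'C(k.-1, r)%:R)); first by ring.
by rewrite eqC; ring.
Qed.

Lemma bin_mean_bin (R : realType) (p : R) r k :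
  bin_mean p k (fun j => 'C(j, r)%:R) = 'C(k, r)%:R * p ^+ r.
Proof.
have := bin_mean_binM p r k (fun=> 1); rewrite bin_mean_cst mulr1 => <-.
by apply: eq_bin_mean => j; rewrite mulr1.
Qed.

(** The ground set is arbitrary so that its elements can be revealed one by one; for
    [complete_graph] this is the expectation in G(n, p). *)
Definition subset_mean (R : realType) (p : R) (T : finType) (E : {set T})
    (F : {set T} -> R) : R :=
  \sum_(G : {set T} | G \subset E)
     (\prod_(e in E) (if e \in G then p else 1 - p)) * F G.

Lemma eq_subset_mean (R : realType) (p : R) (T : finType) (E : {set T})
    (F1 F2 : {set T} -> R) :
  (forall G : {set T}, G \subset E -> F1 G = F2 G) ->
  subset_mean p E F1 = subset_mean p E F2.
Proof. by move=> eqF; apply: eq_bigr => G sG; rewrite eqF. Qed.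

Lemma subset_mean0 (R : realType) (p : R) (T : finType) (F : {set T} -> R) :
  subset_mean p set0 F = F set0.
Proof.
rewrite /subset_mean (eq_bigl (pred1 set0)); last by move=> G; rewrite subset0.
by rewrite big_pred1_eq big_set0 mul1r.
Qed.

Lemma subset_meanU1 (R : realType) (p : R) (T : finType) (E : {set T}) e
    (F : {set T} -> R) :
  e \notin E ->
  subset_mean p (e |: E) F =
  subset_mean p E (fun G => (1 - p) * F G + p * F (e |: G)).
Proof.
move=> eE; rewrite /subset_mean (bigID (fun G : {set T} => e \in G)) /= addrC.
have wtE (G : {set T}) : \prod_(f in e |: E) (if f \in G then p else 1 - p) =
    (if e \in G then p else 1 - p) * \prod_(f in E) (if f \in G then p else 1 - p).
  by rewrite big_setU1.
under [RHS]eq_bigr => G _ do rewrite mulrDr.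
rewrite big_split /=; congr (_ + _).
  apply: eq_big => [G|G /andP[_ eG]].
    apply/andP/idP => [[sG eG]|sG].
      by apply/subsetP => f fG; have := subsetP sG f fG; rewrite !inE;
         case/predU1P => // ef; rewrite -ef fG in eG.
    split; first exact: subset_trans sG (subsetU1 _ _).
    by apply: contra eE; exact: (subsetP sG).
  by rewrite wtE (negPf eG); ring.
(* Subsets containing e correspond to subsets of E by deleting e. *)
rewrite (reindex_onto (fun G => e |: G) (fun G => G :\ e)) /=; last first.
  by move=> G /andP[_ eG]; rewrite setD1K.
apply: eq_big => [G|G /andP[/andP[sG _] /eqP eG]].
  apply/andP/idP => [[/andP[sG _] /eqP eG]|sG].
    apply/subsetP => f fG; have := subsetP sG f; rewrite !inE fG orbT => /(_ isT).
    by case/predU1P => // ef; move: fG; rewrite -eG ef !inE eqxx.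
  have eG : e \notin G by apply: contra eE; exact: (subsetP sG).
  by rewrite setUS // setU11 setU1K.
rewrite wtE setU11 -mulrA [RHS]mulrCA; congr (_ * (_ * _)).
apply: eq_bigr => f fE.
rewrite !inE; case: eqP => // fe; by rewrite -fe fE in eE.
Qed.

Lemma setU1_ind (T : finType) (P : {set T} -> Prop) :
  P set0 -> (forall e (E : {set T}), e \notin E -> P E -> P (e |: E)) ->
  forall E, P E.
Proof.
move=> P0 PU E; have [n cE] := ubnP #|E|.
elim: n => // n IH in E cE *; have [->//|[e eE]] := set_0Vmem E.
rewrite -(setD1K eE); apply: PU; first by rewrite setD11.
by apply: IH; move: cE; rewrite (cardsD1 e E) eE.
Qed.

Lemma subset_mean_le (R : realType) (p : R) (T : finType) (E : {set T})
    (F1 F2 : {set T} -> R) :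
  0 <= p -> p <= 1 -> (forall G : {set T}, G \subset E -> F1 G <= F2 G) ->
  subset_mean p E F1 <= subset_mean p E F2.
Proof.
move=> p0 p1 leF; apply: ler_sum => G sG; apply: ler_wpM2l; last exact: leF.
by apply: prodr_ge0 => e _; case: ifP; rewrite ?subr_ge0.
Qed.

Lemma subset_mean_sum (R : realType) (p : R) (T : finType) (E : {set T})
    (I : finType) (P : pred I) (F : I -> {set T} -> R) :
  subset_mean p E (fun G => \sum_(i | P i) F i G) =
  \sum_(i | P i) subset_mean p E (F i).
Proof.
rewrite /subset_mean exchange_big /=.
by apply: eq_bigr => G _; rewrite mulr_sumr.
Qed.

Lemma subset_meanZ (R : realType) (p : R) (T : finType) (E : {set T}) c
    (F : {set T} -> R) :
  subset_mean p E (fun G => c * F G) = c * subset_mean p E F.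
Proof. by rewrite /subset_mean mulr_sumr; apply: eq_bigr => G _; ring. Qed.

Lemma subset_mean_cst (R : realType) (p : R) (T : finType) (E : {set T}) c :
  subset_mean p E (fun=> c) = c.
Proof.
elim/setU1_ind: E => [|e E eE IH]; first by rewrite subset_mean0.
rewrite subset_meanU1 //; apply: etrans IH.
by apply: eq_subset_mean => G _; ring.
Qed.

Lemma subset_mean_supset (R : realType) (p : R) (T : finType) (E H : {set T}) :
  H \subset E -> subset_mean p E (fun G => (H \subset G)%:R) = p ^+ #|H|.
Proof.
elim/setU1_ind: E H => [|e E eE IH] H.
  by rewrite subset0 => /eqP ->; rewrite subset_mean0 sub0set cards0.
move=> sH; rewrite subset_meanU1 //.
have sHe : H :\ e \subset E by rewrite subDset.
rewrite (cardsD1 e H) exprD -IH // -subset_meanZ.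
apply: eq_subset_mean => G sG; rewrite -subDset.
have [eH|eH] := boolP (e \in H).
  suff -> : (H \subset G) = false by rewrite mulr0 add0r.
  by apply: contraNF eE => /subsetP /(_ e eH); exact: (subsetP sG).
have -> : H :\ e = H by apply/setDidPl; rewrite disjoint_sym disjoints1.
by rewrite expr0; ring.
Qed.

(** Different owners have disjoint blocks of elements, so the block counts are independent
    binomials. The induction reveals one element, which affects only the factor of its owner. *)
Lemma subset_mean_prod_owner (R : realType) (p : R) (T I : finType)
    (own : T -> I) (h : I -> nat -> R) (E : {set T}) :
  subset_mean p E (fun G => \prod_i h i #|[set e in G | own e == i]|) =
  \prod_i bin_mean p #|[set e in E | own e == i]| (h i).
Proof.
elim/setU1_ind: E h => [|e E eE IH] h.
  rewrite subset_mean0; apply: eq_bigr => i _.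
  have -> : [set e in set0 | own e == i] = set0 by apply/setP=> e; rewrite !inE.
  by rewrite cards0.
rewrite subset_meanU1 //.
have cU (G : {set T}) i : e \notin G -> #|[set f in e |: G | own f == i]| =
    ((own e == i) + #|[set f in G | own f == i]|)%N.
  move=> eG; case: eqP => [<-|ne].
    have -> : [set f in e |: G | own f == own e] =
              e |: [set f in G | own f == own e].
      by apply/setP => f; rewrite !inE; case: eqVneq => [->|] //=; rewrite eqxx.
    by rewrite cardsU1 inE (negPf eG).
  rewrite add0n; apply: eq_card => f; rewrite !inE.
  by case: (eqVneq f e) => // ->; rewrite (negPf eG); apply/eqP.
(* Averaging over e applies one step of the [bin_mean] recursion to the owner's factor; hence the
   induction is for all h. *)
pose h' i j := if own e == i then (1 - p) * h i j + p * h i j.+1 else h i j.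
transitivity (subset_mean p E (fun G =>
    \prod_i h' i #|[set e in G | own e == i]|)).
  apply: eq_subset_mean => G sG.
  have eG : e \notin G by apply: contra eE; exact: (subsetP sG).
  pose k i := #|[set f in G | own f == i]|.
  pose Q := \prod_(i | i != own e) h i (k i).
  have -> : \prod_i h i (k i) = h (own e) (k (own e)) * Q.
    by rewrite (bigD1 (own e)).
  have -> : \prod_i h i #|[set f in e |: G | own f == i]| =
            h (own e) (k (own e)).+1 * Q.
    rewrite (bigD1 (own e)) //= cU // eqxx /=; congr (_ * _).
    by apply: eq_bigr => i ne; rewrite cU // eq_sym (negPf ne).
  have -> : \prod_i h' i (k i) =
            ((1 - p) * h (own e) (k (own e)) + p * h (own e) (k (own e)).+1) * Q.
    rewrite (bigD1 (own e)) //= {1}/h' eqxx; congr (_ * _).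
    by apply: eq_bigr => i ne; rewrite /h' eq_sym (negPf ne).
  by move: (h _ _) (h _ _.+1) Q => x y z; ring.
rewrite IH; apply: eq_bigr => i _; rewrite cU // /h'.
by case: (own e == i).
Qed.

(** * Degrees and Finner's inequality *)

Definition degree (T : finType) (v : T) (G : {set {set T}}) : nat :=
  #|[set e in G | v \in e]|.

Lemma degreeU1 (T : finType) (v : T) e (G : {set {set T}}) :
  e \notin G -> degree v (e |: G) = ((v \in e) + degree v G)%N.
Proof.
move=> eG; rewrite /degree; have [ve|ve] := boolP (v \in e).
  have -> : [set f in e |: G | v \in f] = e |: [set f in G | v \in f].
    by apply/setP => f; rewrite !inE; case: eqVneq => [->|].
  by rewrite cardsU1 inE (negPf eG).
rewrite add0n; apply: eq_card => f; rewrite !inE.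
by case: eqVneq => // ->; rewrite (negPf eG) (negPf ve).
Qed.

Lemma degreeS (T : finType) (v : T) (G H : {set {set T}}) :
  G \subset H -> (degree v G <= degree v H)%N.
Proof.
by move=> sGH; apply/subset_leq_card/subsetP => e; rewrite !inE => /andP[/(subsetP sGH)-> ->].
Qed.

Lemma degree0 (T : finType) (v : T) : degree v set0 = 0%N.
Proof. by rewrite /degree; apply: eq_card0 => e; rewrite !inE. Qed.

(** Cauchy-Schwarz for the two-point law of a single edge: after squaring, the sides differ by p (1
    - p) (x y' - x' y)^2. *)
Lemma cauchy_schwarz2 (R : realType) (p x y x' y' : R) :
  0 <= p -> p <= 1 -> 0 <= x -> 0 <= y -> 0 <= x' -> 0 <= y' ->
  (1 - p) * (x * y) + p * (x' * y') <=
  Num.sqrt ((1 - p) * x ^+ 2 + p * x' ^+ 2) *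
  Num.sqrt ((1 - p) * y ^+ 2 + p * y' ^+ 2).
Proof.
move=> p0 p1 x0 y0 x'0 y'0; have q0 : 0 <= 1 - p by rewrite subr_ge0.
have sq0 z z' : 0 <= (1 - p) * z ^+ 2 + p * z' ^+ 2.
  by apply: addr_ge0; apply: mulr_ge0; rewrite ?sqr_ge0.
rewrite -sqrtrM // -[X in X <= _]ger0_norm; last first.
  by apply: addr_ge0; do 2 ?apply: mulr_ge0.
rewrite -sqrtr_sqr ler_sqrt; last exact: mulr_ge0.
rewrite -subr_ge0.
rewrite (_ : _ - _ = p * (1 - p) * (x * y' - x' * y) ^+ 2); last by ring.
by apply: mulr_ge0; [exact: mulr_ge0|exact: sqr_ge0].
Qed.

(* Finner's inequality: each edge is shared by only two vertices, so the
   degrees behave like independent variables up to passing to L^2 norms. *)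
Lemma subset_mean_prod_degree (R : realType) (p : R) (T : finType)
    (h : T -> nat -> R) (E : {set {set T}}) :
  0 <= p -> p <= 1 -> (forall v j, 0 <= h v j) ->
  (forall e, e \in E -> #|e| = 2) ->
  subset_mean p E (fun G => \prod_v h v (degree v G)) <=
  \prod_v Num.sqrt (bin_mean p (degree v E) (fun j => h v j ^+ 2)).
Proof.
move=> p0 p1; elim/setU1_ind: E h => [|e E eE IH] h h0 c2.
  rewrite subset_mean0; apply: ler_prod => v _; rewrite degree0 /=.
  by rewrite h0 sqrtr_sqr ger0_norm ?lexx ?h0.
rewrite subset_meanU1 //.
(* The factors at the two ends of e become L^2 norms over the state of e; the other factors do not
   see e. Squaring [h'] then gives exactly one [bin_mean] step. *)
pose h' v j := if v \in e then
  Num.sqrt ((1 - p) * h v j ^+ 2 + p * h v j.+1 ^+ 2) else h v j.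
have h'0 v j : 0 <= h' v j by rewrite /h'; case: ifP; rewrite ?sqrtr_ge0.
have c2E f : f \in E -> #|f| = 2 by move=> fE; apply: c2; rewrite inE fE orbT.
have /eqP/cards2P[a [b [ab eab]]] := c2 e (setU11 _ _).
have ae : a \in e by rewrite eab !inE eqxx.
have be : b \in e by rewrite eab !inE eqxx orbT.
have ne v : v != a -> v != b -> v \in e = false.
  by rewrite eab !inE => /negPf -> /negPf ->.
have splitP (F : T -> R) : \prod_v F v = F a * F b * \prod_(v | (v != a) && (v != b)) F v.
  by rewrite (bigD1 a) //= (bigD1 b) 1?eq_sym //= mulrA.
apply: le_trans (_ : subset_mean p E (fun G => \prod_v h' v (degree v G)) <= _).
  apply: subset_mean_le => // G sG.
  have eG : e \notin G by apply: contra eE; exact: (subsetP sG).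
  rewrite !splitP {1 2}/h' ae be !degreeU1 // ae be !add1n.
  pose Q := \prod_(v | (v != a) && (v != b)) h v (degree v G).
  rewrite [X in p * (_ * X)](_ : _ = Q); last first.
    by apply: eq_bigr => v /andP[va vb]; rewrite degreeU1 // ne.
  rewrite [X in _ <= _ * X](_ : _ = Q); last first.
    by apply: eq_bigr => v /andP[va vb]; rewrite /h' ne.
  have factQ x y x' y' : (1 - p) * (x * y * Q) + p * (x' * y' * Q) =
    ((1 - p) * (x * y) + p * (x' * y')) * Q by ring.
  rewrite -/Q factQ; apply: ler_wpM2r.
    by apply: prodr_ge0.
  exact: cauchy_schwarz2.
apply: le_trans (IH h' h'0 c2E) _; rewrite le_eqVlt; apply/orP; left; apply/eqP.
apply: eq_bigr => v _; congr Num.sqrt; rewrite degreeU1 // /h'.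
case: (v \in e) => //; rewrite add1n /=; apply: eq_bin_mean => j.
rewrite sqr_sqrtr //; apply: addr_ge0; apply: mulr_ge0; rewrite ?sqr_ge0 //.
by rewrite subr_ge0.
Qed.

(** * Counting stars *)

Lemma set2_injr (T : finType) (v w w' : T) :
  w != v -> [set v; w] = [set v; w'] -> w = w'.
Proof.
move=> wv eqs; have : w \in [set v; w'] by rewrite -eqs !inE eqxx orbT.
by rewrite !inE (negPf wv) => /eqP.
Qed.

Lemma set2_of_card (T : finType) (v : T) (e : {set T}) :
  #|e| = 2 -> v \in e -> exists2 w, w != v & e = [set v; w].
Proof.
move=> /eqP/cards2P[a [b [ab ->]]]; rewrite !inE => /orP[]/eqP ->.
  by exists b; rewrite // eq_sym.
by exists a; rewrite // setUC.
Qed.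

Lemma degree_complete (n : nat) (v : 'I_n) :
  degree v (complete_graph 'I_n) = n.-1.
Proof.
rewrite /degree (_ : [set e in _ | _] = [set [set v; w] | w in [set~ v]]).
  rewrite card_in_imset ?cardsC1 ?card_ord // => w w'; rewrite !inE => wv _.
  exact: set2_injr.
apply/setP => e; rewrite !inE; apply/andP/imsetP => [[/eqP c2 ve]|[w]].
  by have [w wv ->] := set2_of_card c2 ve; exists w; rewrite ?inE.
by rewrite !inE => wv ->; rewrite cards2 [v == w]eq_sym wv !inE eqxx.
Qed.

(** Only edge sets are recorded: for r > 0 the vertex set of a copy is the cover of its edges. *)
Definition stars_at (n r : nat) (G : {set {set 'I_n}}) (v : 'I_n) :
    {set {set {set 'I_n}}} :=
  [set S : {set {set _}} | S \subset [set e in G | v \in e] & #|S| == r].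

Lemma copies_star_ex (n r : nat) (G : {set {set 'I_n}}) F :
  (0 < r)%N -> F \in copies (star r) G ->
  exists2 v, F.2 \in stars_at r G v & F.1 = cover F.2.
Proof.
move=> r0; rewrite inE => /andP[sFG /existsP[f /and3P[/injectiveP injf]]].
move=> /eqP F1 /eqP F2; exists (f ord0).
  rewrite inE; apply/andP; split.
    apply/subsetP => e eF; rewrite inE (subsetP sFG) //=.
    move: eF; rewrite -F2 => /imsetP[s /imsetP[i _ ->] ->].
    by apply/imsetP; exists ord0; rewrite // !inE eqxx.
  rewrite -F2 card_imset; last exact: imset_inj.
  rewrite card_imset ?card_ord // => i j /(set2_injr _) ij.
  by apply: (@lift_inj _ ord0); apply: ij; rewrite eq_sym neq_lift.
rewrite -F1 -F2; apply/setP => x; apply/imsetP/bigcupP => [[j _ ->]|].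
  (* Every vertex of the star lies on an edge; for the centre any edge serves, and one exists
     because r > 0. *)
  have [i [js jst]] : exists i : 'I_r, j \in [set ord0; lift ord0 i] /\ true.
    case: (unliftP ord0 j) => [i ->|->]; first by exists i; rewrite !inE eqxx orbT.
    by exists (Ordinal r0); rewrite !inE eqxx.
  exists (f @: [set ord0; lift ord0 i]).
    by apply/imsetP; exists [set ord0; lift ord0 i] => //; apply/imsetP; exists i.
  exact: imset_f.
by move=> [e /imsetP[s _ ->] /imsetP[j _ ->]]; exists j.
Qed.

Lemma stars_at_copies (n r : nat) (G S : {set {set 'I_n}}) v :
  (0 < r)%N -> G \subset complete_graph 'I_n ->
  S \in stars_at r G v -> (cover S, S) \in copies (star r) G.
Proof.
move=> r0 sG; rewrite !inE => /andP[sS /eqP cS].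
have SG e : e \in S -> [/\ e \in G, v \in e & #|e| = 2].
  move=> /(subsetP sS); rewrite !inE => /andP[eG ve]; split=> //.
  by have := subsetP sG _ eG; rewrite inE => /eqP.
apply/andP; split; first by apply/subsetP => e /SG[].
pose W := [set w | (w != v) && ([set v; w] \in S)].
have SW : S = [set [set v; w] | w in W].
  apply/setP => e; apply/idP/imsetP => [eS|[w]]; last by rewrite inE => /andP[_ wS ->].
  have [_ ve c2] := SG _ eS; have [w wv ee] := set2_of_card c2 ve.
  by exists w; rewrite // inE wv -ee.
have cW : r = #|W|.
  rewrite -cS {1}SW card_in_imset // => w w'; rewrite !inE => /andP[wv _] _.
  exact: set2_injr.
pose g (i : 'I_r) : 'I_n := enum_val (cast_ord cW i).
have gW i : g i \in W by apply: enum_valP.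
have ginj : injective g by move=> i j /enum_val_inj /cast_ord_inj.
have Wg w : w \in W -> exists i, w = g i.
  move=> wW; exists (cast_ord (esym cW) (enum_rank_in wW w)).
  by rewrite /g cast_ordKV enum_rankK_in.
(* The centre goes to v and the leaves to an enumeration of the other endpoints. *)
pose f : {ffun 'I_r.+1 -> 'I_n} := [ffun j => if unlift ord0 j is Some i then g i else v].
have f0 : f ord0 = v by rewrite ffunE unlift_none.
have fl i : f (lift ord0 i) = g i by rewrite ffunE liftK.
have gv i : g i != v by have := gW i; rewrite inE => /andP[].
apply/existsP; exists f; apply/and3P; split.
- apply/injectiveP => i j.
  case: (unliftP ord0 i) => [i' ->|->]; case: (unliftP ord0 j) => [j' ->|->];
    rewrite ?fl ?f0 //.
  + by move=> /ginj ->.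
  + by move=> /eqP; rewrite (negPf (gv _)).
  + by move=> /esym/eqP; rewrite (negPf (gv _)).
- apply/eqP/setP => x; apply/imsetP/bigcupP => [[j _ ->]|[e eS xe]].
    case: (unliftP ord0 j) => [i ->|->].
      exists [set v; g i]; last by rewrite fl !inE eqxx orbT.
      by rewrite SW; apply: imset_f.
    exists [set v; g (Ordinal r0)]; last by rewrite f0 !inE eqxx.
    by rewrite SW; apply: imset_f.
  move: eS xe; rewrite SW => /imsetP[w /Wg[i ->] ->].
  by rewrite !inE => /orP[]/eqP ->; [exists ord0|exists (lift ord0 i)].
have fe i : f @: [set ord0; lift ord0 i] = [set v; g i].
  by rewrite imsetU !imset_set1 f0 fl.
rewrite {2}SW; apply/eqP/setP => e; apply/imsetP/imsetP.
  by move=> [s /imsetP[i _ ->] ->]; rewrite fe; exists (g i).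
move=> [w /Wg[i ->] ->]; exists [set ord0; lift ord0 i]; last by rewrite fe.
exact: imset_f.
Qed.

(** Copies correspond to pairs of a centre and r edges through it. For r >= 2 the centre is unique,
    since two distinct edges share at most one vertex. *)
Lemma star_countE (n r : nat) (G : {set {set 'I_n}}) :
  (2 <= r)%N -> G \subset complete_graph 'I_n ->
  star_count r G = (\sum_v 'C(degree v G, r))%N.
Proof.
move=> r2 sG; have r0 : (0 < r)%N by apply: leq_trans r2.
pose B := [set vS : 'I_n * {set {set 'I_n}} | vS.2 \in stars_at r G vS.1].
have -> : (\sum_v 'C(degree v G, r) = #|B|)%N.
  rewrite -sum1_card (eq_bigr (fun v => \sum_(S in stars_at r G v) 1)%N).
    by rewrite pair_big_dep; apply: eq_bigl => -[v S]; rewrite !inE.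
  by move=> v _; rewrite sum1_card cards_draws.
rewrite /star_count.
have -> : copies (star r) G = [set (cover vS.2, vS.2) | vS in B].
  apply/setP => F; apply/idP/imsetP => [FC|[[v S]]].
    have [v F2 F1] := copies_star_ex r0 FC.
    by exists (v, F.2); [rewrite inE|case: F F1 {FC F2} => F1 F2 /= ->].
  by rewrite inE /= => SB ->; exact: stars_at_copies SB.
rewrite card_in_imset // => -[v S] [w S']; rewrite !inE /=.
move=> /andP[sv /eqP cS] /andP[sw _] [_ eS]; subst S'; congr (_, _).
(* Two distinct centres would both lie in every edge of S, leaving at most one edge. *)
apply/eqP/negPn/negP => vw; move: r2; rewrite -cS leqNgt ltnS => /negP; apply.
rewrite -(cards1 [set v; w]); apply/subset_leq_card/subsetP => e eS.
have := subsetP sv _ eS; have := subsetP sw _ eS; rewrite !inE.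
move=> /andP[_ we] /andP[eG ve].
have /eqP c2 : #|e| == 2 by have := subsetP sG _ eG; rewrite inE.
have [u uv eu] := set2_of_card c2 ve.
by move: we; rewrite eu !inE eq_sym (negPf vw) => /eqP ->.
Qed.

Lemma gnp_probE (R : realType) (n : nat) (p : R) (A : pred {set {set 'I_n}}) :
  gnp_prob p A = subset_mean p (complete_graph 'I_n) (fun G => (A G)%:R).
Proof.
rewrite /gnp_prob /subset_mean big_mkcondr /=; apply: eq_bigr => G _.
by rewrite /gnp_mass; case: (A G); rewrite ?mulr1 ?mulr0.
Qed.

Lemma complete_graph_card2 (n : nat) e : e \in complete_graph 'I_n -> #|e| = 2.
Proof. by rewrite inE => /eqP. Qed.

(** The Boolean owner [v \in e] splits the edges into those at v and the rest. *)
Lemma subset_mean_degree (R : realType) (n : nat) (p : R) (v : 'I_n)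
    (h : nat -> R) :
  subset_mean p (complete_graph 'I_n) (fun G => h (degree v G)) =
  bin_mean p n.-1 h.
Proof.
rewrite -(degree_complete v).
pose h' (b : bool) := if b then h else fun=> 1.
have := subset_mean_prod_owner p (fun e : {set 'I_n} => v \in e) h'
  (complete_graph 'I_n).
rewrite big_bool /= bin_mean_cst mulr1.
have eqd (G : {set {set 'I_n}}) : [set e in G | (v \in e) == true] = [set e in G | v \in e].
  by apply/setP => e; rewrite !inE eqb_id.
rewrite eqd => <-; apply: eq_subset_mean => G _.
by rewrite big_bool /= mulr1 eqd.
Qed.

Lemma star_meanE (R : realType) (r n : nat) (p : R) :
  (2 <= r)%N -> star_mean r n p = n%:R * ('C(n.-1, r)%:R * p ^+ r).
Proof.
move=> r2; transitivity (subset_mean p (complete_graph 'I_n)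
    (fun G => \sum_(v : 'I_n) 'C(degree v G, r)%:R)).
  apply: eq_bigr => G sG; rewrite star_countE // natr_sum.
  by rewrite /gnp_mass.
rewrite subset_mean_sum (eq_bigr (fun=> 'C(n.-1, r)%:R * p ^+ r)).
  by rewrite sumr_const card_ord [RHS]mulr_natl.
by move=> v _; rewrite -bin_mean_bin -(subset_mean_degree p v).
Qed.

Lemma star_count_complete (r n : nat) :
  (2 <= r)%N -> star_count r (complete_graph 'I_n) = (n * 'C(n.-1, r))%N.
Proof.
move=> r2; rewrite star_countE // (eq_bigr (fun=> 'C(n.-1, r))).
  by rewrite sum_nat_const card_ord.
by move=> v _; rewrite degree_complete.
Qed.

(** * Moment bounds *)

Lemma expR_sub1_le (R : realType) (x : R) : expR x <= 1 + x * expR x.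
Proof.
have := ler_wpM2r (expR_ge0 x) (expR_ge1Dx (- x)).
by rewrite -expRD addNr expR0 mulrDl mulNr mul1r lerBlDr.
Qed.

Lemma sqrt_expR (R : realType) (x : R) : Num.sqrt (expR (2 * x)) = expR x.
Proof.
by rewrite (_ : 2 * x = x + x) ?expRD -?expr2 ?sqrtr_sqr ?ger0_norm ?expR_ge0 //; ring.
Qed.

(** Exponential Markov inequality with tilt lam. Finner's inequality splits the moment generating
    function over the vertices, and size biasing turns the excess of each factor into a share of the
    mean times a moment of a shifted binomial. *)
Lemma truncated_star_tail (R : realType) (r n : nat) (p lam y : R)
    (S : pred nat) :
  (2 <= r)%N -> 0 <= p -> p <= 1 -> 0 <= lam ->
  gnp_prob p (fun G : {set {set 'I_n}} =>
    y <= \sum_v 'C(degree v G, r)%:R * (S (degree v G))%:R) <=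
  expR (- lam * (y - star_mean r n p * bin_mean p (n.-1 - r)
    (fun j => (S (j + r)%N)%:R * expR (2 * (lam * 'C(j + r, r)%:R))))).
Proof.
move=> r2 p0 p1 lam0; set tau := bin_mean _ _ _.
pose g j : R := 'C(j, r)%:R * (S j)%:R.
rewrite gnp_probE.
apply: (@le_trans _ _ (subset_mean p (complete_graph 'I_n)
    (fun G => expR (- lam * y) * \prod_v expR (lam * g (degree v G))))).
  apply: subset_mean_le => // G sG.
  rewrite -expR_sum -expRD -mulr_sumr mulNr -mulrN -mulrDr addrC.
  case le_y: (y <= _); last exact: expR_ge0.
  rewrite -[X in X <= _]expR0 ler_expR mulr_ge0 // subr_ge0.
  exact: le_y.
rewrite subset_meanZ star_meanE // mulrBr expRD; apply: ler_wpM2l.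
  exact: expR_ge0.
apply: le_trans (subset_mean_prod_degree
  (h := fun (_ : 'I_n) j => expR (lam * g j)) p0 p1 _ _) _.
- by move=> v j; exact: expR_ge0.
- exact: complete_graph_card2.
rewrite (eq_bigr (fun=> Num.sqrt (bin_mean p n.-1
  (fun j => expR (2 * (lam * g j)))))); last first.
  move=> v _; rewrite degree_complete; congr Num.sqrt.
  by apply: eq_bin_mean => j; rewrite expRM_natl.
rewrite prodr_const card_ord.
set c : R := 'C(n.-1, r)%:R * p ^+ r.
(* Since e^x <= 1 + x e^x, the excess over 1 carries a factor C(j, r), to which size biasing
   applies; 1 + y <= e^y restores an exponential. *)
have le1 : bin_mean p n.-1 (fun j => expR (2 * (lam * g j))) <=
           expR (2 * (lam * (c * tau))).
  apply: (@le_trans _ _ (bin_mean p n.-1 (fun j => 1 + 2 * lam * ('C(j, r)%:R *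
     ((S j)%:R * expR (2 * (lam * 'C(j, r)%:R))))))).
    apply: bin_mean_le => // j _; apply: le_trans (expR_sub1_le _) _.
    rewrite /g; case: (S j); rewrite ?mulr0 ?mul0r ?mulr0 ?mulr1 ?mul1r //.
    by rewrite !mulrA.
  rewrite bin_meanD bin_mean_cst bin_meanZ bin_mean_binM -/tau.
  apply: le_trans (expR_ge1Dx _); rewrite -!mulrA; exact: lexx.
have -> : - (- lam * (n%:R * c * tau)) = n%:R * (lam * (c * tau)) by ring.
rewrite expRM_natl; apply: lerXn2r; rewrite ?nnegrE ?sqrtr_ge0 ?expR_ge0 //.
by rewrite -sqrt_expR ler_sqrt ?expR_ge0.
Qed.

(** Chernoff's bound: Markov's inequality for s^j, and 1 - p + p s <= exp(p (s - 1)). *)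
Lemma bin_mean_geq_le (R : realType) (p s x : R) N :
  0 <= p -> p <= 1 -> 1 <= s ->
  bin_mean p N (fun j => (x <= j%:R)%R%:R) <=
  expR (N%:R * p * (s - 1) - x * ln s).
Proof.
move=> p0 p1 s1; have s0 : 0 < s by apply: lt_le_trans s1.
apply: (@le_trans _ _ (expR (- (x * ln s)) * bin_mean p N (fun j => s ^+ j))).
  rewrite -bin_meanZ; apply: bin_mean_le => // j _.
  rewrite -[s in s ^+ j]lnK ?posrE // -expRM_natl -expRD.
  have [xj|_] := boolP (x <= j%:R); last exact: expR_ge0.
  by rewrite -[X in X <= _]expR0 ler_expR addrC subr_ge0 ler_wpM2r ?ln_ge0.
rewrite addrC expRD; apply: ler_wpM2l; first exact: expR_ge0.
rewrite bin_mean_exp -mulrA expRM_natl; apply: lerXn2r.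
- by rewrite nnegrE addr_ge0 ?subr_ge0 // mulr_ge0 // ltW.
- by rewrite nnegrE expR_ge0.
apply: le_trans (expR_ge1Dx _); rewrite le_eqVlt; apply/orP; left; apply/eqP.
by ring.
Qed.

(** The term i = j alone dominates h j. This reduces moments to tail probabilities, which Chernoff's
    bound controls. *)
Lemma bin_mean_le_sum (R : realType) (p : R) N (h : nat -> R) :
  0 <= p -> p <= 1 -> (forall j, 0 <= h j) ->
  bin_mean p N h <=
  \sum_(i < N.+1) h i * bin_mean p N (fun j => (i <= j)%:R).
Proof.
move=> p0 p1 h0; rewrite -bin_mean_sum; apply: bin_mean_le => // j jN.
have jN1 : (j < N.+1)%N by [].
rewrite (bigD1 (Ordinal jN1)) //= leqnn mulr1 lerDl.
by apply: sumr_ge0 => i _; rewrite mulr_ge0.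
Qed.

Lemma geometric_sum_le (R : realType) (q : R) N :
  0 <= q -> q < 1 -> \sum_(i < N) q ^+ i <= (1 - q)^-1.
Proof.
move=> q0 q1; have q1' : 0 < 1 - q by rewrite subr_gt0.
rewrite -(ler_pM2l q1') divff ?gt_eqF //.
rewrite -opprB mulNr -subrX1 opprB lerBlDr lerDl exprn_ge0 //.
Qed.

(** The factor 2 comes from r! >= 2; in [tilt_le] it pays for the doubled exponent produced by
    Finner's inequality. *)
Lemma bin_le_half_pow (R : realType) (r d : nat) :
  (2 <= r)%N -> 2 * 'C(d, r)%:R <= d%:R ^+ r :> R.
Proof.
move=> r2; rewrite -natrM -natrX ler_nat.
have f2 : (2 <= r`!)%N by apply: leq_trans (fact_geq r).
apply: leq_trans (leq_mul f2 (leqnn _)) _; rewrite mulnC bin_ffact.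
by elim: (r) => // k IH; rewrite ffactnSr expnSr leq_mul // leq_subr.
Qed.

Lemma ln_inv_le (R : realType) (x : R) : 0 < x -> - ln x * x <= 1 - x.
Proof.
move=> x0; rewrite -lnV // -ler_pdivlMr //.
have xV : 0 < x^-1 by rewrite invr_gt0.
have := @le_ln1Dx R (x^-1 - 1); rewrite (addrC 1) subrK => h.
apply: le_trans (h _) _; first by lra.
by rewrite mulrBl mul1r divff // gt_eqF.
Qed.

Lemma ln1D_gt (R : realType) (x : R) : 0 < x -> x / (1 + x) < ln (1 + x).
Proof.
move=> x0; have x1 : 0 < 1 + x by lra.
rewrite -ltr_expR lnK ?posrE //.
have : 1 + - (x / (1 + x)) < expR (- (x / (1 + x))).
  by apply: expR_gt1Dx; rewrite oppr_eq0 mulf_neq0 ?invr_eq0 ?gt_eqF.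
rewrite expRN (_ : 1 + _ = (1 + x)^-1); last by field; lra.
by rewrite ltf_pV2 // posrE expR_gt0.
Qed.

(* With x = d / L, the quantity x^(r-1) ln(1/p) is at most a multiple of
   ln(d/m) + 1 because - x ln x <= 1 - x. *)
Lemma tilt_le (R : realType) (r d : nat) (A del p m L lam : R) :
  (2 <= r)%N -> 0 < A -> 0 <= del -> 0 < m -> 0 < L -> m <= d%:R -> d%:R <= L ->
  ln (p^-1) <= A * ln (L / m) + A ->
  0 <= lam -> lam * L ^+ r.-1 <= del * ln (p^-1) ->
  2 * (lam * 'C(d, r)%:R) <= d%:R * (del * A) * (ln (d%:R / m) + 1).
Proof.
move=> r2 A0 del0 m0 L0 md dL lnp lam0 lamL.
have d0 : 0 < d%:R :> R by apply: lt_le_trans md.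
pose x := d%:R / L.
have x0 : 0 < x by rewrite divr_gt0.
have x1 : x <= 1 by rewrite ler_pdivrMr // mul1r.
have dx : d%:R = x * L by rewrite /x divfK // gt_eqF.
have lnLm : ln (L / m) = ln (d%:R / m) - ln x.
  rewrite -ln_div ?posrE ?divr_gt0 // /x; congr ln; field.
  by rewrite !gt_eqF.
have lnd0 : 0 <= ln (d%:R / m) by rewrite ln_ge0 // ler_pdivlMr // mul1r.
rewrite mulrCA; apply: le_trans (ler_wpM2l lam0 (bin_le_half_pow R d r2)) _.
have -> : d%:R ^+ r = d%:R * (d%:R ^+ r.-1) :> R by rewrite -exprS prednK // (ltn_trans _ r2).
rewrite mulrCA -mulrA; apply: ler_wpM2l; first exact: ltW.
have xr : x ^+ r.-1 <= x.
  rewrite -[X in _ <= X]expr1; apply: ler_wiXn2l => //; [exact: ltW|].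
  by case: (r) r2 => [|[]].
apply: (@le_trans _ _ (x * (lam * L ^+ r.-1))).
  rewrite [X in X ^+ _]dx exprMn mulrCA; apply: ler_wpM2r => //.
  by rewrite mulr_ge0 // exprn_ge0 // ltW.
apply: (@le_trans _ _ (x * (del * ln (p^-1)))); first by apply: ler_wpM2l => //; exact: ltW.
rewrite mulrCA -mulrA; apply: ler_wpM2l => //.
apply: (@le_trans _ _ (x * (A * ln (L / m) + A))); first by apply: ler_wpM2l => //; exact: ltW.
rewrite -[X in _ + X]mulr1 -mulrDr mulrCA; apply: ler_wpM2l; first exact: ltW.
rewrite lnLm.
have h := ln_inv_le x0.
have : x * ln (d%:R / m) <= ln (d%:R / m) by rewrite ler_piMl.
move: h; set a := ln x; set b := ln _ => h1 h2.
by rewrite (_ : _ * (b - a + 1) = x * b + - a * x + x); [lra|ring].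
Qed.

(** With d = j + r, the Chernoff exponent has to beat the tilt by kap d. For d / m bounded it is
    linear in d, so a small del suffices; for d / m large both are of order d ln(d / m), with
    coefficients 1/2 against 1/4. *)
Lemma tail_term_le (R : realType) (r : nat) (eta A : R) :
  (2 <= r)%N -> 0 < eta -> 0 < A ->
  exists kap del : R, [/\ 0 < kap, 0 < del &
  forall (N j : nat) (p m L lam : R), 0 <= p -> p <= 1 -> 0 < m ->
    N%:R * p <= m -> 0 < L -> ln (p^-1) <= A * ln (L / m) + A ->
    0 <= lam -> lam * L ^+ r.-1 <= del * ln (p^-1) ->
    (1 + eta) * m <= (j + r)%:R -> (r <= j)%N -> (j + r)%:R <= L ->
    expR (2 * (lam * 'C(j + r, r)%:R)) * bin_mean p N (fun i => (j <= i)%:R) <=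
    (1 + eta) ^+ r * expR (- kap * (j + r)%:R)].
Proof.
move=> r2 eta0 A0.
(* The Chernoff gain per unit of d at s = 1 + eta is 2 kap: one half is spent on the tilt, the other
   is kept. *)
pose kap := (ln (1 + eta) - eta / (1 + eta)) / 2.
have kap0 : 0 < kap by rewrite divr_gt0 // subr_gt0 ln1D_gt.
(* For l >= l0 the surplus d l / 4 covers the error terms d + d / 4 and leaves kap d. *)
pose l0 := 5 + 4 * kap.
pose del := Num.min (4^-1) (kap / (l0 + 1)) / A.
have l00 : 0 < l0 + 1 by rewrite /l0; lra.
have delA : del * A = Num.min (4^-1) (kap / (l0 + 1)).
  by rewrite /del divfK // gt_eqF.
have del0 : 0 < del by rewrite divr_gt0 // lt_min invr_gt0 ltr0n divr_gt0.
have delA1 : del * A <= 4^-1 by rewrite delA ge_min lexx.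
have delA2 : del * A * (l0 + 1) <= kap.
  by rewrite -ler_pdivlMr // delA ge_min lexx orbT.
exists kap, del; split => // N j p m L lam p0 p1 m0 Npm L0 lnp lam0 lamL md rj dL.
set d := (j + r)%N in md dL *.
have md' : m <= d%:R by apply: le_trans md; nra.
have d0 : 0 < d%:R :> R by apply: lt_le_trans md'.
have := tilt_le r2 A0 (ltW del0) m0 L0 md' dL lnp lam0 lamL.
rewrite -ler_expR => le_tilt.
have eta1 : 1 <= 1 + eta by lra.
set l := ln (d%:R / m) in le_tilt.
have chern (s : R) : 1 <= s -> bin_mean p N (fun i => (j <= i)%:R) <=
    expR (m * (s - 1) - j%:R * ln s).
  move=> s1; rewrite (eq_bin_mean _ _ (h2 := fun i => (j%:R <= i%:R :> R)%R%:R)).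
    apply: le_trans (bin_mean_geq_le _ _ p0 p1 s1) _.
    by rewrite ler_expR lerD2r ler_wpM2r // subr_ge0.
  by move=> i; rewrite ler_nat.
have jE : j%:R = d%:R - r%:R :> R by rewrite /d natrD; ring.
have r0 : 0 <= r%:R :> R by [].
have rjR : r%:R <= j%:R :> R by rewrite ler_nat.
(* For moderate d take s = 1 + eta; replacing j by d - r costs the factor (1 + eta)^r. *)
have [ll0|ll0] := leP l l0.
  have := chern _ eta1; rewrite (_ : 1 + eta - 1 = eta); last by ring.
  move=> chern1.
  apply: le_trans (ler_pM _ _ le_tilt chern1) _; rewrite ?expR_ge0 //.
    exact: bin_mean_ge0.
  rewrite -expRD -[X in X ^+ r](@lnK R (1 + eta)) ?posrE; last by lra.
  rewrite -expRM_natl -expRD ler_expR jE addrC [1 + eta]addrC.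
  have etam : m * eta <= d%:R * (eta / (1 + eta)).
    rewrite mulrA ler_pdivlMr; last by lra.
    have := ler_wpM2r (ltW eta0) md; lra.
  have tiltl : d%:R * (del * A) * (l + 1) <= d%:R * kap.
    rewrite -mulrA; apply: ler_wpM2l; first exact: ltW.
    apply: le_trans delA2; apply: ler_wpM2l; last by lra.
    by rewrite mulr_ge0 // ltW.
  have kapE : ln (eta + 1) = 2 * kap + eta / (1 + eta).
    by rewrite /kap [eta + 1]addrC; field; lra.
  move: etam tiltl; rewrite kapE; set q := eta / _.
  set t := _ * (l + 1); nra.
(* For large d take the optimal s = d / m, using j >= d / 2. *)
have s1 : 1 <= d%:R / m by rewrite ler_pdivlMr // mul1r.
have := chern _ s1; rewrite -/l => chern2.
apply: le_trans (ler_pM _ _ le_tilt chern2) _; rewrite ?expR_ge0 //.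
  exact: bin_mean_ge0.
rewrite -expRD; apply: (@le_trans _ _ (expR (- kap * d%:R))); last first.
  by rewrite -[X in X <= _]mul1r ler_wpM2r ?expR_ge0 ?exprn_ege1.
rewrite ler_expR.
have l1 : 0 <= l by rewrite ln_ge0.
have -> : m * (d%:R / m - 1) = d%:R - m by field; rewrite gt_eqF.
have jd : d%:R / 2 * l <= j%:R * l.
  by apply: ler_wpM2r => //; move: rjR; rewrite jE; lra.
have tiltl : d%:R * (del * A) * (l + 1) <= d%:R * (4^-1 * (l + 1)).
  by rewrite -mulrA; apply: ler_wpM2l; [exact: ltW|apply: ler_wpM2r => //; lra].
have : d%:R * l0 <= d%:R * l by apply: ler_wpM2l; exact: ltW.
rewrite /l0; move: tiltl jd; set t := _ * (l + 1).
have -> : - kap * d%:R = - (d%:R * kap) by ring.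
set x := d%:R * kap; set y := j%:R * l.
rewrite [d%:R * (5 + _)](_ : _ = 5 * d%:R + 4 * x); last by rewrite /x; ring.
rewrite [d%:R * (4^-1 * _)](_ : _ = (d%:R * l) / 4 + d%:R / 4); last by field.
rewrite [d%:R / 2 * l](_ : _ = (d%:R * l) / 2); last by field.
set z := d%:R * l; lra.
Qed.

(** The terms decay like e^(-kap d). Half of the exponent makes the series geometric; the other
    half, with d >= B, pushes the total below tau. *)
Lemma tail_moment_le (R : realType) (r : nat) (eta A tau : R) :
  (2 <= r)%N -> 0 < eta -> 0 < A -> 0 < tau ->
  exists del B : R, [/\ 0 < del, 0 < B &
  forall (N : nat) (p m L lam : R) (S : pred nat), 0 <= p -> p <= 1 -> 0 < m ->
    N%:R * p <= m -> 0 < L -> ln (p^-1) <= A * ln (L / m) + A ->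
    0 <= lam -> lam * L ^+ r.-1 <= del * ln (p^-1) ->
    (forall d : nat, S d -> [/\ (1 + eta) * m <= d%:R, B <= d%:R & d%:R <= L]) ->
    bin_mean p N
      (fun j => (S (j + r)%N)%:R * expR (2 * (lam * 'C(j + r, r)%:R))) <= tau].
Proof.
move=> r2 eta0 A0 tau0; have [kap [del [kap0 del0 term]]] := tail_term_le r2 eta0 A0.
pose q := expR (- (kap / 2)).
have q1 : q < 1 by rewrite expR_lt1 oppr_lt0 divr_gt0.
have q0 : 0 < q by exact: expR_gt0.
pose W := (1 + eta) ^+ r / (1 - q).
have W0 : 0 < W by rewrite divr_gt0 ?subr_gt0 // exprn_gt0 //; lra.
(* The first entry turns d >= B into j >= r, the second gives W e^(-kap B / 2) <= tau. *)
pose B := Num.max (2 * r%:R) (2 / kap * ln (W / tau)).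
have B2r : 2 * r%:R <= B by rewrite le_max lexx.
have BW : 2 / kap * ln (W / tau) <= B by rewrite le_max lexx orbT.
have rR : 0 < r%:R :> R by rewrite ltr0n ltnW.
exists del, B; split => //; first by lra.
move=> N p m L lam S p0 p1 m0 Npm L0 lnp lam0 lamL SP.
apply: le_trans (bin_mean_le_sum _ p0 p1 _) _.
  by move=> j; rewrite mulr_ge0 ?expR_ge0.
apply: (@le_trans _ _ (\sum_(i < N.+1) (1 + eta) ^+ r * expR (- (kap / 2 * B)) * q ^+ i)).
  apply: ler_sum => i _; case Si: (S (i + r)%N); last first.
    rewrite !mul0r !mulr_ge0 ?expR_ge0 ?exprn_ge0 //; last exact: ltW.
    by lra.
  have [md Bd dL] := SP _ Si.
  have ri : (r <= i)%N.
    by have := le_trans B2r Bd; rewrite -natrM ler_nat mulSn mul1n leq_add2r.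
  rewrite mul1r; apply: le_trans (term _ _ _ _ _ _ p0 p1 m0 Npm L0 lnp lam0 lamL md ri dL) _.
  rewrite -mulrA; apply: ler_wpM2l; first by rewrite exprn_ge0 //; lra.
  rewrite /q -expRM_natl -expRD ler_expR.
  have iR : i%:R <= (i + r)%:R :> R by rewrite ler_nat leq_addr.
  have h1 : kap / 2 * B <= kap / 2 * (i + r)%:R by rewrite ler_wpM2l //; lra.
  have h2 : kap / 2 * i%:R <= kap / 2 * (i + r)%:R by rewrite ler_wpM2l //; lra.
  move: h1 h2; set b := _ * B; set a := (i + r)%:R; set c := i%:R => h1 h2.
  by move: h1 h2; lra.
rewrite -mulr_sumr; apply: le_trans (ler_wpM2l _ (geometric_sum_le _ (ltW q0) q1)) _.
  by rewrite mulr_ge0 ?expR_ge0 // exprn_ge0 //; lra.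
have Wt0 : 0 < W / tau by exact: divr_gt0.
have kap2 : 0 <= kap / 2 by lra.
have := ler_wpM2l kap2 BW; rewrite mulrA (_ : kap / 2 * (2 / kap) = 1); last first.
  by field; rewrite gt_eqF.
rewrite mul1r => lnW; rewrite mulrAC -/W expRN ler_pdivrMr ?expR_gt0 //.
rewrite mulrC -ler_pdivrMr // -[X in X <= _]lnK ?posrE //.
by rewrite ler_expR.
Qed.

(** * The upper bound on the tail probability *)

Lemma expn_le_ffact (k r : nat) : ((k.+1 - r) ^ r <= k ^_ r)%N.
Proof.
rewrite ffact_prod -[X in (_ ^ X <= _)%N](card_ord r) -prod_nat_const.
apply: leq_prod => i _; by rewrite -[(k - i)%N]subSS leq_sub2l.
Qed.

Lemma ffact_le_expn (k r : nat) : (k ^_ r <= k ^ r)%N.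
Proof. by elim: r => // r IH; rewrite ffactnSr expnSr leq_mul // leq_subr. Qed.

Lemma bin_le_expn (k r : nat) : ('C(k, r) <= k ^ r)%N.
Proof.
by apply: leq_trans (ffact_le_expn k r); rewrite -bin_ffact leq_pmulr // fact_gt0.
Qed.

Lemma fact_le_expn (r : nat) : (r`! <= r ^ r)%N.
Proof. by rewrite -ffactnn ffact_le_expn. Qed.

Lemma bin_pow_le (R : realType) (r n : nat) (p : R) :
  (0 < n)%N -> 0 <= p ->
  ((n - r)%:R * p) ^+ r <= r`!%:R * ('C(n.-1, r)%:R * p ^+ r).
Proof.
move=> n0 p0; rewrite exprMn mulrA; apply: ler_wpM2r; first exact: exprn_ge0.
rewrite -natrM -natrX ler_nat mulnC bin_ffact.
by case: n n0 => // n _; exact: expn_le_ffact.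
Qed.

Lemma star_mean_le (R : realType) (r n : nat) (p : R) :
  (2 <= r)%N -> 0 <= p -> star_mean r n p <= n%:R ^+ r.+1 * p ^+ r.
Proof.
move=> r2 p0; rewrite star_meanE // exprS -mulrA; apply: ler_wpM2l => //.
apply: ler_wpM2r; first exact: exprn_ge0.
rewrite -natrX ler_nat; apply: leq_trans (bin_le_expn _ _) _.
by case: n => // n /=; rewrite leq_exp2r ?leqnSn // ltnW.
Qed.

Lemma star_mean_ge (R : realType) (r n : nat) (p : R) :
  (2 <= r)%N -> (0 < n)%N -> 0 <= p ->
  n%:R * ((n - r)%:R * p) ^+ r <= r`!%:R * star_mean r n p.
Proof.
move=> r2 n0 p0; rewrite star_meanE // mulrCA; apply: ler_wpM2l => //.
exact: bin_pow_le.
Qed.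

(** As mu <= n^(r+1) p^r, a mean bounded below forces p to be at least a constant times a negative
    power of n. *)
Lemma ln_inv_p_le (R : realType) (r n : nat) (p eps : R) :
  (2 <= r)%N -> (0 < n)%N -> 0 < p -> 0 < eps ->
  1 <= (1 + eps) * star_mean r n p ->
  r%:R * ln (p^-1) <= ln (1 + eps) + r.+1%:R * ln (n%:R).
Proof.
move=> r2 n0 p0 eps0 mu1; have nR : 0 < n%:R :> R by rewrite ltr0n.
have eps1 : 0 < 1 + eps by lra.
have : 1 <= (1 + eps) * (n%:R ^+ r.+1 * p ^+ r).
  by apply: le_trans mu1 _; apply: ler_wpM2l; [lra|apply: star_mean_le => //; exact: ltW].
move/ln_ge0; rewrite !lnM ?posrE ?mulr_gt0 ?exprn_gt0 // !lnXn // lnV ?posrE //.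
rewrite -[ln p *+ r]mulr_natl -[ln n%:R *+ r.+1]mulr_natl.
move: (ln p) (ln n%:R) (ln (1 + eps)) => a b c.
by clear; rewrite mulrN; move: (r%:R * a) (r.+1%:R * b) => x y; lra.
Qed.

(* The truncation level L = min (n, K mu^(1/r)) satisfies the hypothesis of
   tail_moment_le because (L/m)^r >= n whenever L < n. *)
Lemma ln_inv_p_le_level (R : realType) (r n : nat) (p eps rho K : R) :
  (2 <= r)%N -> (r < n)%N -> 0 < p -> p <= 1 -> 0 < eps ->
  1 <= (1 + eps) * star_mean r n p -> 0 < rho -> rho ^+ r = star_mean r n p ->
  r%:R <= K ->
  let m := (n - r)%:R * p in
  ln (n%:R) + r%:R * ln (K / r%:R) <= r%:R * ln (K * rho / m) /\
  ln (p^-1) <= (r.+1%:R + ln (1 + eps)) * ln (Num.min n%:R (K * rho) / m)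
               + (r.+1%:R + ln (1 + eps)).
Proof.
move=> r2 rn p0 p1 eps0 mu1 rho0 rhoE rK m.
have r0 : (0 < r)%N by rewrite ltnW.
have n0 : (0 < n)%N by apply: leq_ltn_trans rn.
have rR : 0 < r%:R :> R by rewrite ltr0n.
have r1 : 1 <= r%:R :> R by rewrite ler1n.
have nR : 0 < n%:R :> R by rewrite ltr0n.
have K0 : 0 < K by apply: lt_le_trans rK.
have m0 : 0 < m by rewrite mulr_gt0 // ltr0n subn_gt0.
have le1 : ln (n%:R) + r%:R * ln (K / r%:R) <= r%:R * ln (K * rho / m).
  have -> : r%:R * ln (K * rho / m) = ln ((K * rho / m) ^+ r).
    by rewrite lnXn ?mulr_natl // divr_gt0 // mulr_gt0.
  have -> : r%:R * ln (K / r%:R) = ln ((K / r%:R) ^+ r).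
    by rewrite lnXn ?mulr_natl // divr_gt0.
  rewrite -lnM ?posrE ?exprn_gt0 ?divr_gt0 // ler_ln ?posrE; last 2 first.
  - by rewrite mulr_gt0 // exprn_gt0 // divr_gt0.
  - by rewrite exprn_gt0 // divr_gt0 // mulr_gt0.
  rewrite !exprMn !exprVn rhoE ler_pdivlMr ?exprn_gt0 //.
  rewrite mulrCA -!mulrA; apply: ler_wpM2l; first by rewrite exprn_ge0 // ltW.
  rewrite mulrC -mulrA -ler_pdivlMl ?invr_gt0 ?exprn_gt0 // invrK mulrC.
  have := star_mean_ge r2 n0 (ltW p0); rewrite -/m => h; apply: le_trans h _.
  apply: ler_wpM2r; first by rewrite -rhoE exprn_ge0 // ltW.
  by rewrite -natrX ler_nat fact_le_expn.
split => //.
have le2 := ln_inv_p_le r2 n0 p0 eps0 mu1.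
have leps : 0 <= ln (1 + eps) by rewrite ln_ge0 //; lra.
have rSr : r.+1%:R = r%:R + 1 :> R by rewrite natr1.
(* If L = n, then L / m >= 1 / p outright; otherwise ln(1/p) is controlled by ln n, and ln n by r
   ln(L / m). *)
have [nK|Kn] := leP n%:R (K * rho).
  have mnp : m <= n%:R * p by rewrite ler_wpM2r ?(ltW p0) // ler_nat leq_subr.
  have le3 : ln (p^-1) <= ln (n%:R / m).
    rewrite ler_ln ?posrE ?invr_gt0 ?divr_gt0 // ler_pdivlMr // mulrC.
    by rewrite ler_pdivrMr.
  have p1' : 0 <= ln (p^-1) by rewrite ln_ge0 // invf_ge1.
  set a := ln _ in leps *; set b := ln (n%:R / m) in le3 *; rewrite rSr; nra.
have lnK : 0 <= ln (K / r%:R) by rewrite ln_ge0 // ler_pdivlMr // mul1r.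
have lnn : 0 <= ln (n%:R : R) by rewrite ln_ge0 // ler1n.
set a := ln (1 + _) in leps le2 *; set b := ln (K * rho / m) in le1 *.
set l := ln (p^-1) in le2 *.
have rlK : 0 <= r%:R * ln (K / r%:R) by rewrite mulr_ge0 // ltW.
have nb : ln n%:R <= r%:R * b by lra.
have b0 : 0 <= b by rewrite -(pmulr_rge0 _ rR); lra.
have le4 : r%:R * l <= r%:R * (r.+1%:R * b + a).
  apply: le_trans le2 _; rewrite mulrDr addrC mulrCA; apply: lerD.
    by apply: ler_wpM2l.
  by rewrite ler_peMl.
move: le4; rewrite ler_pM2l // => /le_trans; apply.
have : 0 <= a * b by exact: mulr_ge0.
by rewrite mulrDl; lra.
Qed.

Lemma gnp_prob_le (R : realType) (n : nat) (p : R) (A B : pred {set {set 'I_n}}) :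
  0 <= p -> p <= 1 ->
  (forall G : {set {set 'I_n}}, G \subset complete_graph 'I_n -> A G -> B G) ->
  gnp_prob p A <= gnp_prob p B.
Proof.
move=> p0 p1 AB; rewrite !gnp_probE; apply: subset_mean_le => // G sG.
by have := AB G sG; case: (A G) => [->|] //; rewrite ler_nat.
Qed.

Lemma gnp_prob_leU (R : realType) (n : nat) (p : R) (A B C : pred {set {set 'I_n}}) :
  0 <= p -> p <= 1 ->
  (forall G : {set {set 'I_n}}, G \subset complete_graph 'I_n -> A G -> B G || C G) ->
  gnp_prob p A <= gnp_prob p B + gnp_prob p C.
Proof.
move=> p0 p1 ABC; rewrite !gnp_probE.
rewrite -big_split /=; apply: ler_sum => G sG; rewrite -mulrDr.
apply: ler_wpM2l; first by apply: prodr_ge0 => e _; case: ifP; rewrite ?subr_ge0.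
by rewrite -natrD ler_nat; have := ABC G sG; case: (A G) (B G) (C G) => [] [] [] // /(_ isT).
Qed.

Lemma gnp_prob_markov (R : realType) (r n : nat) (p y : R) :
  0 <= p -> p <= 1 -> 0 < y ->
  gnp_prob p (fun G : {set {set 'I_n}} => y <= (star_count r G)%:R) <=
  star_mean r n p / y.
Proof.
move=> p0 p1 y0; rewrite ler_pdivlMr // mulrC gnp_probE -subset_meanZ.
apply: subset_mean_le => // G sG.
by case: (leP y) => [yX|_] /=; rewrite ?mulr1 ?mulr0.
Qed.

(** This makes the degree threshold (1 + eta) m correspond exactly to a factor 1 + eps in the star
    count. *)
Lemma bernoulli_root (R : realType) (r : nat) (eps : R) :
  (0 < r)%N -> 0 < eps -> exists2 eta : R, 0 < eta & (1 + eta) ^+ r = 1 + eps.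
Proof.
move=> r0 eps0; exists ((1 + eps) `^ (r%:R^-1) - 1).
  have pow1 : 1 `^ (r%:R^-1) = 1 :> R by rewrite powR1.
  rewrite subr_gt0 -[X in X < _]pow1 gt0_ltr_powR ?nnegrE //.
  - by rewrite invr_gt0 ltr0n.
  - by lra.
  - by lra.
rewrite addrC subrK -powR_mulrn ?powR_ge0 // -powRrM mulVf ?powRr1 //; first by lra.
by rewrite pnatr_eq0 -lt0n.
Qed.

Definition level_count (R : realType) (n r : nat) (L : R) (G : {set {set 'I_n}}) : R :=
  \sum_v 'C(degree v G, r)%:R * ((degree v G)%:R <= L :> R)%R%:R.

(* For m >= B the vertices of degree at most (1 + eta) m are negligible
   deterministically; for m < B they have a bounded number of stars. *)
Lemma level_count_tail (R : realType) (r : nat) (eps A : R) :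
  (2 <= r)%N -> 0 < eps -> 0 < A ->
  exists2 del : R, 0 < del &
  forall (n : nat) (p L lam : R), (r < n)%N -> 0 < p -> p <= 1 -> 0 < L ->
    ln (p^-1) <= A * ln (L / ((n - r)%:R * p)) + A ->
    0 <= lam -> lam <= del -> lam * L ^+ r.-1 <= del * ln (p^-1) ->
    gnp_prob p (fun G : {set {set 'I_n}} =>
      (1 + eps) * star_mean r n p <= level_count r L G) <=
    expR (- (eps / 4 * (lam * star_mean r n p))).
Proof.
move=> r2 eps0 A0; have r0 : (0 < r)%N by rewrite ltnW.
have e20 : 0 < eps / 2 by lra.
have e40 : 0 < eps / 4 by lra.
have [eta eta0 etaE] := bernoulli_root r0 e20.
have [del [B [del0 B0 tail]]] := tail_moment_le r2 eta0 A0 e40.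
(* When m < B, every degree d >= T satisfies both d >= (1 + eta) m and d >= B. *)
have [T TE] : exists T : nat, (1 + eta) * B <= T%:R.
  exists (Num.bound ((1 + eta) * B)); apply: ltW.
  by apply: le_lt_trans (archi_boundP _) => //; rewrite ?ler_norm // mulr_ge0 //; lra.
have TB : B <= T%:R by apply: le_trans TE; rewrite ler_peMl //; lra.
have lne : 0 < ln (1 + eps / 4) by rewrite ln_gt0 //; lra.
have cT0 : 0 < 2 * 'C(T, r)%:R + 1 :> R by rewrite ltr_wpDl // mulr_ge0.
(* With so small a tilt, the exponential weight of a degree below T is at most 1 + eps / 4. *)
pose del' := Num.min del (ln (1 + eps / 4) / (2 * 'C(T, r)%:R + 1)).
have del'1 : del' <= del by rewrite ge_min lexx.
have del'2 : del' * (2 * 'C(T, r)%:R + 1) <= ln (1 + eps / 4).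
  by rewrite -ler_pdivlMr // ge_min lexx orbT.
have del'0 : 0 < del' by rewrite lt_min del0 divr_gt0.
exists del' => // n p L lam rn p0 p1 L0 lnp lam0 lamdel lamL.
have n0 : (0 < n)%N by apply: leq_ltn_trans rn.
set m := (n - r)%:R * p in lnp.
have m0 : 0 < m by rewrite mulr_gt0 // ltr0n subn_gt0.
have Nm : (n.-1 - r)%:R * p <= m.
  by rewrite ler_wpM2r ?(ltW p0) // ler_nat leq_sub2r // leq_pred.
have lnp0 : 0 <= ln (p^-1) by rewrite ln_ge0 // invf_ge1.
have lamL' : lam * L ^+ r.-1 <= del * ln (p^-1).
  by apply: le_trans lamL _; exact: ler_wpM2r.
have mu0 : 0 <= star_mean r n p by rewrite star_meanE // !mulr_ge0 // exprn_ge0 // ltW.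
set mu := star_mean r n p in mu0 *.
have [Bm|mB] := leP B m.
  pose S (d : nat) := ((1 + eta) * m <= d%:R) && (d%:R <= L).
  have SP d : S d -> [/\ (1 + eta) * m <= d%:R, B <= d%:R & d%:R <= L].
    move=> /andP[h1 h2]; split=> //; apply: le_trans h1; apply: le_trans Bm _.
    by rewrite ler_peMl ?(ltW m0) //; lra.
  have := tail _ _ _ _ _ S (ltW p0) p1 m0 Nm L0 lnp lam0 lamL' SP.
  set tau := bin_mean _ _ _ => tauP.
  apply: le_trans (_ : gnp_prob p (fun G : {set {set 'I_n}} =>
    eps / 2 * mu <= \sum_v 'C(degree v G, r)%:R * (S (degree v G))%:R) <= _).
    apply: gnp_prob_le (ltW p0) p1 _ => G sG leX.
    (* Degrees d < (1 + eta) m have C(d, r) <= (1 + eps / 2) m^r / r!, so such vertices contribute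
       at most (1 + eps / 2) mu; the others must supply eps mu / 2. *)
    have : level_count r L G <= (1 + eps / 2) * mu +
        \sum_v 'C(degree v G, r)%:R * (S (degree v G))%:R.
      have -> : (1 + eps / 2) * mu = \sum_(v : 'I_n) (1 + eps / 2) * ('C(n.-1, r)%:R * p ^+ r).
        by rewrite /mu star_meanE // sumr_const card_ord -[RHS]mulr_natl; ring.
      rewrite -big_split /=; apply: ler_sum => v _; rewrite /S.
      have [dm|md] := leP ((1 + eta) * m) (degree v G)%:R.
        by rewrite lerDr mulr_ge0 ?mulr_ge0 ?exprn_ge0 ?(ltW p0) //; lra.
      rewrite /= mulr0 addr0.
      apply: (@le_trans _ _ 'C(degree v G, r)%:R).
        by rewrite ler_piMr // lern1 leq_b1.
      have rf : 0 < r`!%:R :> R by rewrite ltr0n fact_gt0.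
      rewrite -(ler_pM2l rf); apply: (@le_trans _ _ ((degree v G)%:R ^+ r)).
        by rewrite -natrM -natrX ler_nat mulnC bin_ffact ffact_le_expn.
      apply: (@le_trans _ _ (((1 + eta) * m) ^+ r)).
        by apply: lerXn2r; rewrite ?nnegrE ?ler0n ?(ltW md) // mulr_ge0 ?(ltW m0) //; lra.
      rewrite exprMn etaE [in X in _ <= X]mulrCA; apply: ler_wpM2l; first by lra.
      by apply: bin_pow_le => //; exact: ltW.
    by move: leX; set X := level_count _ _ _; set Y := \sum_v _; lra.
  apply: le_trans (truncated_star_tail _ _ _ r2 (ltW p0) p1 lam0) _.
  rewrite ler_expR -/tau -/mu mulNr lerN2.
  have : lam * (mu * tau) <= lam * (mu * (eps / 4)).
    by apply: ler_wpM2l => //; exact: ler_wpM2l.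
  by rewrite mulrBr; lra.
pose S (d : nat) := (d%:R <= L :> R).
pose S' (d : nat) := (T%:R <= d%:R :> R) && (d%:R <= L).
have SP d : S' d -> [/\ (1 + eta) * m <= d%:R, B <= d%:R & d%:R <= L].
  move=> /andP[h1 h2]; split=> //; last exact: le_trans h1.
  by apply: le_trans h1; apply: le_trans TE; apply: ler_wpM2l; [lra|exact: ltW].
have := tail _ _ _ _ _ S' (ltW p0) p1 m0 Nm L0 lnp lam0 lamL' SP.
set tau' := bin_mean _ _ _ => tauP.
apply: le_trans (truncated_star_tail _ _ S r2 (ltW p0) p1 lam0) _.
set tau := bin_mean _ _ _.
(* Degrees below T contribute at most 1 + eps / 4 and those above at most eps / 4; the sum 1 + eps /
   2 still falls short of 1 + eps. *)
have tau_le : tau <= (1 + eps / 4) + eps / 4.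
  apply: (@le_trans _ _ (1 + eps / 4 + tau')); last by rewrite lerD2l.
  rewrite -[X in _ <= X + _](bin_mean_cst p (n.-1 - r)) -bin_meanD.
  apply: bin_mean_le (ltW p0) p1 _ => j _; rewrite /S /S'.
  have [Tj|jT] := leP T%:R ((j + r)%:R : R); first by rewrite lerDr; lra.
  rewrite mul0r addr0; case: (leP _ L) => _; last by rewrite mul0r; lra.
  rewrite mul1r -[X in _ <= X]lnK ?posrE ?ler_expR; last by lra.
  apply: le_trans del'2; rewrite mulrCA; apply: ler_pM => //; first by rewrite mulr_ge0.
  apply: ler_wpDr => //; apply: ler_wpM2l => //; rewrite ler_nat.
  by apply: leq_bin2l; rewrite -(ler_nat R) ltW.
rewrite ler_expR -/mu mulNr lerN2.
have : lam * (mu * tau) <= lam * (mu * ((1 + eps / 4) + eps / 4)).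
  by apply: ler_wpM2l => //; exact: ler_wpM2l.
have : 0 <= eps / 4 * (lam * mu) by apply: mulr_ge0; [exact: ltW|exact: mulr_ge0].
by rewrite mulrBr; lra.
Qed.

(** * Large degrees *)

Lemma predn_le_mul_sub (r n : nat) : (r < n)%N -> (n.-1 <= r.+1 * (n - r))%N.
Proof.
move=> rn; rewrite -(subnKC rn) addSn -addnS addKn addnS /= mulSn mulnS.
by rewrite addnCA leq_add2l (leq_trans (leqnSn _)) // leq_addr.
Qed.

Lemma root_ge1 (R : realType) (r : nat) (eps rho : R) :
  (0 < r)%N -> 0 < eps -> 0 < rho -> 1 <= (1 + eps) * rho ^+ r ->
  1 <= (1 + eps) * rho.
Proof.
move=> r0 eps0 rho0 h; have [rho1|/ltW rho1] := leP rho 1; last by nra.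
apply: le_trans h _; apply: ler_wpM2l; first by lra.
by rewrite -[X in _ <= X]expr1; apply: ler_wiXn2l => //; exact: ltW.
Qed.

Lemma max_rate_le_root (R : realType) (r n : nat) (rho : R) :
  (0 < r)%N -> 0 < rho -> rho <= n%:R ->
  Num.max rho (rho ^+ r / n%:R ^+ r.-1) <= rho.
Proof.
move=> r0 rho0 rhon; have n0 : 0 < n%:R :> R by apply: lt_le_trans rhon.
rewrite ge_max lexx /= ler_pdivrMr ?exprn_gt0 // -[X in _ ^+ X <= _](prednK r0) exprS.
by apply: ler_wpM2l; [exact: ltW|apply: lerXn2r; rewrite ?nnegrE // ltW].
Qed.

(** For L = K rho < n, Chernoff's bound for one degree at s = L / ((r + 1) m) has exponent about L
    ln(L / m), and K is large enough to absorb the ln n of the union bound. For L = n the event is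
    empty. *)
Lemma max_degree_tail (R : realType) (r : nat) (eps : R) :
  (2 <= r)%N -> 0 < eps ->
  exists K c : R, [/\ r%:R <= K, 0 < c &
  forall (n : nat) (p rho : R), (r < n)%N -> 0 < p -> p <= 1 ->
    1 <= (1 + eps) * star_mean r n p -> 0 < rho -> rho ^+ r = star_mean r n p ->
    gnp_prob p (fun G : {set {set 'I_n}} =>
      [exists v, Num.min n%:R (K * rho) < (degree v G)%:R :> R]) <=
    expR (- (c * (Num.max rho (rho ^+ r / n%:R ^+ r.-1) * ln (p^-1))))].
Proof.
move=> r2 eps0; have r0 : (0 < r)%N by rewrite ltnW.
have rR : 0 < r%:R :> R by rewrite ltr0n.
have rR1 : 1 <= r%:R :> R by rewrite ler1n.
pose b : R := ln r.+1%:R; have b0 : 0 <= b by rewrite ln_ge0 // ler1n.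
pose e := expR (4 * (1 + b)); have e0 : 0 < e by exact: expR_gt0.
(* The summand e makes ln(K / r) >= 4 (1 + b), and 4 (1 + eps) makes L >= 4 r; these bound the two
   error terms by L Lam / 4 each. *)
pose K := r%:R * (e + 4 * (1 + eps)).
have K4r : 4 * r%:R * (1 + eps) <= K by rewrite /K; nra.
have rK : r%:R <= K by apply: le_trans K4r; nra.
pose A : R := r.+1%:R + ln (1 + eps).
have A0 : 0 < A by rewrite ltr_wpDr // ln_ge0 //; lra.
have K0 : 0 < K by lra.
have lnKr : 4 * (1 + b) <= ln (K / r%:R).
  rewrite -[X in X <= _]expRK ler_ln ?posrE ?expR_gt0 ?divr_gt0 //.
  rewrite ler_pdivlMr // mulrC /K; apply: ler_wpM2l; first exact: ltW.
  by rewrite -/e; lra.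
exists K, (4 * A)^-1; split=> //; first by rewrite invr_gt0; lra.
move=> n p rho rn p0 p1 mu1 rho0 rhoE.
have n0 : (0 < n)%N by apply: leq_ltn_trans rn.
have [] := ln_inv_p_le_level r2 rn p0 p1 eps0 mu1 rho0 rhoE rK.
set m := (n - r)%:R * p; rewrite -/A.
have m0 : 0 < m by rewrite mulr_gt0 // ltr0n subn_gt0.
have [nK _ _|Kn] := leP n%:R (K * rho).
  rewrite gnp_probE; apply: le_trans (expR_ge0 _).
  rewrite -[X in _ <= X](subset_mean_cst p (complete_graph 'I_n)).
  apply: subset_mean_le (ltW p0) p1 _ => G sG.
  case: existsP => // -[v]; rewrite ltr_nat ltnNge.
  have := degreeS v sG; rewrite degree_complete => dv.
  by rewrite (leq_trans dv) // leq_pred.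
set L := K * rho in Kn *; set Lam := ln (L / m) => lnLam lnp.
have L0 : 0 < L by rewrite mulr_gt0.
have lnn : 0 <= ln (n%:R : R) by rewrite ln_ge0 // ler1n.
have Lam4 : 4 * (1 + b) <= Lam.
  apply: le_trans lnKr _; rewrite -(ler_pM2l rR).
  by apply: le_trans lnLam; rewrite lerDr.
have rhoge : 1 <= (1 + eps) * rho by apply: root_ge1 r0 eps0 rho0 _; rewrite rhoE.
have L4r : 4 * r%:R <= L.
  apply: le_trans (_ : 4 * r%:R * ((1 + eps) * rho) <= _).
    by rewrite ler_peMr //; lra.
  by rewrite mulrA ler_wpM2r // ltW.
have lnn_le : ln (n%:R) <= L * Lam / 4.
  have h1 : ln n%:R <= r%:R * Lam.
    apply: le_trans lnLam; rewrite lerDl mulr_ge0 //; lra.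
  have h2 : 4 * r%:R * Lam <= L * Lam by apply: ler_wpM2r => //; lra.
  by move: h1 h2; rewrite -mulrA; set x := r%:R * Lam; lra.
have Lb : L * (1 + b) <= L * Lam / 4.
  by rewrite -mulrA; apply: ler_wpM2l; [exact: ltW|lra].
pose s := L / (r.+1%:R * m).
have rm0 : 0 < r.+1%:R * m by rewrite mulr_gt0.
have lns : ln s = Lam - b.
  rewrite /Lam /b -ln_div ?posrE ?divr_gt0 //; congr ln.
  by rewrite /s invfM mulrA mulrAC.
have s1 : 1 <= s by rewrite -ler_ln ?posrE ?divr_gt0 // ln1 lns; lra.
have Np : n.-1%:R * p <= r.+1%:R * m.
  rewrite mulrA; apply: ler_wpM2r; first exact: ltW.
  by rewrite -natrM ler_nat predn_le_mul_sub.
have exL : n.-1%:R * p * (s - 1) <= L.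
  apply: le_trans (_ : r.+1%:R * m * (s - 1) <= _).
    by apply: ler_wpM2r => //; rewrite subr_ge0.
  by rewrite mulrBr mulr1 /s mulrC divfK ?gt_eqF // gerBl ltW.
rewrite gnp_probE; apply: (@le_trans _ _ (subset_mean p (complete_graph 'I_n)
    (fun G => \sum_v (L <= (degree v G)%:R)%R%:R))).
  apply: subset_mean_le (ltW p0) p1 _ => G sG.
  case: existsP => [[v Lv]|_]; last by rewrite sumr_ge0.
  by rewrite (bigD1 v) //= (ltW Lv) lerDl sumr_ge0.
rewrite subset_mean_sum (eq_bigr (fun=> bin_mean p n.-1 (fun j => (L <= j%:R)%R%:R))); last first.
  by move=> v _; rewrite -(subset_mean_degree p v).
rewrite sumr_const card_ord -[X in X <= _]mulr_natl.
apply: (@le_trans _ _ (expR (ln n%:R) * expR (n.-1%:R * p * (s - 1) - L * ln s))).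
  rewrite lnK ?posrE ?ltr0n //; apply: ler_wpM2l => //.
  exact: bin_mean_geq_le (ltW p0) p1 s1.
rewrite -expRD ler_expR lns.
set M := Num.max _ _.
have ML : M <= L.
  have rhoL : rho <= L by rewrite /L ler_peMl ?(ltW rho0) //; lra.
  apply: (le_trans _ rhoL); apply: max_rate_le_root => //.
  exact: ltW (le_lt_trans rhoL Kn).
have lnp2 : ln (p^-1) <= 2 * A * Lam.
  apply: le_trans lnp _; have : A <= A * Lam by rewrite ler_peMr ?(ltW A0) //; lra.
  by set x := A * Lam; rewrite -mulrA -/x; lra.
have lnp0 : 0 <= ln (p^-1) by rewrite ln_ge0 // invf_ge1.
have Mlnp : M * ln (p^-1) <= L * (2 * A * Lam).
  apply: ler_pM => //.
  by rewrite le_max ltW.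
(* Of L Lam, one quarter goes to the union bound and one to L (1 + b). The remaining half covers M
   ln(1/p) / (4 A), as M ln(1/p) <= 2 A L Lam. *)
have final : (4 * A)^-1 * (M * ln p^-1) <= L * Lam / 2.
  rewrite ler_pdivrMl; last by lra.
  by apply: le_trans Mlnp _; rewrite le_eqVlt; apply/orP; left; apply/eqP; field.
move: exL lnn_le Lb final; clear.
set u := _ * (s - 1); set w := _ * (M * _); set l := ln n%:R.
rewrite mulrBr mulrDr mulr1; set x := L * Lam; set y := L * b.
lra.
Qed.

(** If c Phi >= 2 ln 2, half of the exponent absorbs the factor 2. Otherwise Phi is bounded and the
    constant bound 1 / (1 + eps) suffices. *)
Lemma absorb_factor2 (R : realType) (eps c P Phi : R) :
  0 < eps -> 0 < c -> 0 <= Phi -> P <= 2 * expR (- (c * Phi)) ->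
  P <= (1 + eps)^-1 ->
  P <= expR (- (c * Num.min 2^-1 (ln (1 + eps) / (2 * ln 2)) * Phi)).
Proof.
move=> eps0 c0 Phi0 P2 P1; set k := Num.min _ _.
have ln20 : 0 < ln (2 : R) by rewrite ln_gt0 // ltr1n.
have cP0 : 0 <= c * Phi by rewrite mulr_ge0 // ltW.
have kE : c * k * Phi = (c * Phi) * k by ring.
rewrite kE; have [big|small] := leP (2 * ln 2) (c * Phi).
  apply: le_trans P2 _; rewrite -[X in X * _](@lnK R 2) ?posrE // -expRD ler_expR.
  have : c * Phi * k <= c * Phi * 2^-1 by apply: ler_wpM2l => //; rewrite ge_min lexx.
  by move: big; set x := c * Phi; set y := ln 2; lra.
apply: le_trans P1 _; rewrite -[X in X^-1 <= _]lnK ?posrE; last by lra.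
rewrite -expRN ler_expR lerN2.
apply: (@le_trans _ _ (c * Phi * (ln (1 + eps) / (2 * ln 2)))).
  by apply: ler_wpM2l => //; rewrite ge_min lexx orbT.
rewrite mulrA ler_pdivrMr; last by lra.
rewrite mulrC; apply: ler_wpM2l; last exact: ltW.
by rewrite ln_ge0 //; lra.
Qed.

(* The function Phi of the theorem, with rho standing for mu^(1/r). *)
Definition tail_rate (R : realType) (r n : nat) (p rho : R) : R :=
  Num.min (rho ^+ r) (Num.max rho (rho ^+ r / n%:R ^+ r.-1) * ln (p^-1)).

(** Converts the exponent lam mu into Phi: mu / L^(r-1) is at least rho / K^(r-1) because L <= K
    rho, and at least mu / n^(r-1) because L <= n. *)
Lemma tail_rate_le_level (R : realType) (r n : nat) (p rho K L : R) :
  (0 < r)%N -> 0 < rho -> 1 <= K -> 0 <= ln (p^-1) ->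
  0 < L -> L <= n%:R -> L <= K * rho ->
  tail_rate r n p rho <=
  K ^+ r.-1 * (Num.min 1 (ln (p^-1) / L ^+ r.-1) * rho ^+ r).
Proof.
move=> r0 rho0 K1 lnp0 L0 Ln LK; rewrite /tail_rate.
have n0 : 0 < n%:R :> R by apply: lt_le_trans Ln.
have K0 : 0 < K by lra.
have Kr : 1 <= K ^+ r.-1 by rewrite exprn_ege1.
have rr0 : 0 <= rho ^+ r by rewrite exprn_ge0 // ltW.
have Lr0 : 0 < L ^+ r.-1 by rewrite exprn_gt0.
have [h|h] := leP 1 (ln (p^-1) / L ^+ r.-1).
  by rewrite ge_min mul1r ler_peMl.
rewrite ge_min; apply/orP; right.
set l := ln _ in lnp0 h *; set a := K ^+ r.-1 in Kr *.
set b := L ^+ r.-1 in Lr0 h *.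
have -> : a * (l / b * rho ^+ r) = (a * rho ^+ r / b) * l.
  by rewrite !mulrA [a * l]mulrC -!mulrA [l * _]mulrC !mulrA [a / b * _]mulrAC.
apply: ler_wpM2r => //; rewrite ge_max; apply/andP; split.
  rewrite ler_pdivlMr // -[X in _ ^+ X](prednK r0) exprS mulrCA -exprMn.
  apply: ler_wpM2l; first exact: ltW.
  by apply: lerXn2r; rewrite ?nnegrE ?mulr_ge0 // ltW.
rewrite -mulrA; apply: (@le_trans _ _ (rho ^+ r / b)); last first.
  by rewrite ler_peMl // divr_ge0 // ltW.
apply: ler_wpM2l => //; rewrite lef_pV2 ?posrE ?exprn_gt0 //.
by apply: lerXn2r; rewrite ?nnegrE // ltW.
Qed.

Lemma upper_tail_prob_le (R : realType) (r : nat) (eps : R) :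
  (2 <= r)%N -> 0 < eps ->
  exists2 c : R, 0 < c &
  forall (n : nat) (p rho : R), (r < n)%N -> 0 < p -> p <= 1 ->
    1 <= (1 + eps) * star_mean r n p -> 0 < rho -> rho ^+ r = star_mean r n p ->
    gnp_prob p (fun G : {set {set 'I_n}} =>
      (1 + eps) * star_mean r n p <= (star_count r G)%:R) <=
    expR (- (c * tail_rate r n p rho)).
Proof.
move=> r2 eps0; have r0 : (0 < r)%N by rewrite ltnW.
pose A : R := r.+1%:R + ln (1 + eps).
have leps : 0 < ln (1 + eps) by rewrite ln_gt0 //; lra.
have A0 : 0 < A by rewrite addr_gt0.
have [del del0 trunc] := level_count_tail r2 eps0 A0.
have [K [c [rK c0 maxdeg]]] := max_degree_tail r2 eps0.
have K1 : 1 <= K by apply: le_trans rK; rewrite ler1n.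
have Kr0 : 0 < K ^+ r.-1 by rewrite exprn_gt0 //; lra.
pose c1 := eps / 4 * (del / K ^+ r.-1).
have c10 : 0 < c1 by rewrite mulr_gt0 ?divr_gt0.
pose c2 := Num.min c1 c.
have c20 : 0 < c2 by rewrite lt_min c10.
have ln20 : 0 < ln (2 : R) by rewrite ln_gt0 // ltr1n.
exists (c2 * Num.min 2^-1 (ln (1 + eps) / (2 * ln 2))).
  by rewrite mulr_gt0 // lt_min invr_gt0 ltr0n divr_gt0 // mulr_gt0.
move=> n p rho rn p0 p1 mu1 rho0 rhoE.
have n0 : (0 < n)%N by apply: leq_ltn_trans rn.
have nR : 0 < n%:R :> R by rewrite ltr0n.
have lnp0 : 0 <= ln (p^-1) by rewrite ln_ge0 // invf_ge1.
have mu0 : 0 < star_mean r n p by rewrite -rhoE exprn_gt0.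
pose L := Num.min n%:R (K * rho).
have L0 : 0 < L by rewrite lt_min nR mulr_gt0 //; lra.
have Ln : L <= n%:R by rewrite ge_min lexx.
have LK : L <= K * rho by rewrite ge_min lexx orbT.
have [_ lnp] := ln_inv_p_le_level r2 rn p0 p1 eps0 mu1 rho0 rhoE rK.
(* The largest tilt with lam <= del and lam L^(r-1) <= del ln(1/p). *)
pose lam := del * Num.min 1 (ln (p^-1) / L ^+ r.-1).
have Lr0 : 0 < L ^+ r.-1 by rewrite exprn_gt0.
have lam0 : 0 <= lam by rewrite mulr_ge0 ?(ltW del0) // le_min ler01 divr_ge0 // ltW.
have lamdel : lam <= del by rewrite ler_piMr ?(ltW del0) // ge_min lexx.
have lamL : lam * L ^+ r.-1 <= del * ln (p^-1).
  rewrite -mulrA; apply: ler_wpM2l; first exact: ltW.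
  by rewrite -ler_pdivlMr // ge_min lexx orbT.
have P1 := trunc n p L lam rn p0 p1 L0 lnp lam0 lamdel lamL.
have P2 := maxdeg n p rho rn p0 p1 mu1 rho0 rhoE.
have rate0 : 0 <= tail_rate r n p rho.
  rewrite le_min exprn_ge0 ?(ltW rho0) //= mulr_ge0 //.
  by rewrite le_max ltW.
have rate1 := tail_rate_le_level r0 rho0 K1 lnp0 L0 Ln LK.
apply: absorb_factor2 => //; last first.
  apply: le_trans (gnp_prob_markov _ _ (ltW p0) p1 _) _.
    by rewrite mulr_gt0 //; lra.
  by rewrite invfM mulrCA divff ?mulr1 // gt_eqF.
(* Either some degree exceeds L, or the truncated count is the full count. *)
apply: le_trans (gnp_prob_leU (ltW p0) p1 (B := fun G : {set {set 'I_n}} =>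
  (1 + eps) * star_mean r n p <= level_count r L G) (C := fun G : {set {set 'I_n}} =>
      [exists v, Num.min n%:R (K * rho) < (degree v G)%:R :> R]) _) _.
  move=> G sG cG; case: existsP => [//|nex]; rewrite ?orbT // orbF.
  apply: le_trans cG _; rewrite star_countE // natr_sum; apply: ler_sum => v _.
  case: (leP (degree v G)%:R L) => [|Lv]; first by rewrite mulr1.
  by case: nex; exists v.
rewrite mulr_natl mulr2n; apply: lerD.
  apply: le_trans P1 _; rewrite ler_expR lerN2.
  apply: (@le_trans _ _ (c1 * tail_rate r n p rho)).
    by apply: ler_wpM2r => //; rewrite ge_min lexx.
  rewrite /c1 -mulrA; apply: ler_wpM2l; first by lra.
  rewrite /lam -rhoE -!mulrA; apply: ler_wpM2l; first exact: ltW.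
  by rewrite ler_pdivrMl.
apply: le_trans P2 _; rewrite ler_expR lerN2.
apply: (@le_trans _ _ (c * tail_rate r n p rho)).
  by apply: ler_wpM2r => //; rewrite ge_min lexx orbT.
by apply: ler_wpM2l; [exact: ltW|rewrite ge_min lexx orbT].
Qed.

(** * The lower bound on the tail probability *)

Lemma star_countS (r n : nat) (G H : {set {set 'I_n}}) :
  (2 <= r)%N -> H \subset G -> G \subset complete_graph 'I_n ->
  (star_count r H <= star_count r G)%N.
Proof.
move=> r2 HG GK; rewrite !star_countE //; last exact: subset_trans GK.
by apply: leq_sum => v _; apply: leq_bin2l; exact: degreeS.
Qed.

(** Star counts are monotone in the graph, and all edges of H are present with probability p^|H|. *)
Lemma gnp_prob_plant (R : realType) (r n : nat) (p y : R) (H : {set {set 'I_n}}) :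
  (2 <= r)%N -> 0 <= p -> p <= 1 -> H \subset complete_graph 'I_n ->
  y <= (star_count r H)%:R ->
  p ^+ #|H| <= gnp_prob p (fun G : {set {set 'I_n}} => y <= (star_count r G)%:R).
Proof.
move=> r2 p0 p1 HK yH; rewrite gnp_probE -(subset_mean_supset p HK).
apply: subset_mean_le => // G GK; case HG: (H \subset G) => //.
suff -> : y <= (star_count r G)%:R by [].
by apply: le_trans yH _; rewrite ler_nat star_countS.
Qed.

Lemma exists_subset_card (T : finType) (B : {set T}) (s : nat) :
  (s <= #|B|)%N -> exists2 A : {set T}, A \subset B & #|A| = s.
Proof.
rewrite -bin_gt0 -cards_draws => /card_gt0P[A].
by rewrite inE => /andP[AB /eqP]; exists A.
Qed.

Lemma exists_star_graph (r n s : nat) :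
  (2 <= r)%N -> (0 < n)%N -> (s <= n.-1)%N ->
  exists H : {set {set 'I_n}}, [/\ H \subset complete_graph 'I_n,
    #|H| = s & ('C(s, r) <= star_count r H)%N].
Proof.
move=> r2 n0 sn; pose v := Ordinal n0.
have := sn; rewrite -(degree_complete v) => /exists_subset_card[H HB cH].
exists H; have HK : H \subset complete_graph 'I_n.
  by apply: subset_trans HB _; apply/subsetP => e; rewrite inE => /andP[].
split=> //; rewrite star_countE // (bigD1 v) //=.
suff -> : degree v H = s by apply: leq_addr.
rewrite -cH; apply: eq_card => e; rewrite !inE; case eH: (e \in H) => //=.
by have := subsetP HB e eH; rewrite inE => /andP[].
Qed.

Lemma exists_full_vertices_graph (r n k : nat) :
  (2 <= r)%N -> (k <= n)%N ->
  exists H : {set {set 'I_n}}, [/\ H \subset complete_graph 'I_n,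
    (#|H| <= k * n)%N & (k * 'C(n.-1, r) <= star_count r H)%N].
Proof.
move=> r2 kn; pose V := [set v : 'I_n | (v < k)%N].
have cV : #|V| = k.
  have winj : injective (widen_ord kn) 
    by move=> i j /(congr1 val) /= ij; apply: val_inj.
  rewrite -[RHS](card_ord k) -(card_imset predT winj).
  apply: eq_card => v; rewrite inE; apply/idP/imsetP => [vk|[i _ ->]] /=.
    by exists (Ordinal vk) => //; apply: val_inj.
  exact: ltn_ord.
pose H := [set e in complete_graph 'I_n | [exists v in V, v \in e]].
have HK : H \subset complete_graph 'I_n by apply/subsetP => e; rewrite inE => /andP[].
have dH v : v \in V -> degree v H = n.-1.
  move=> vV; rewrite -(degree_complete v); apply: eq_card => e; rewrite !inE.
  case ve: (v \in e); rewrite ?andbF // !andbT.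
  have -> : [exists w in V, w \in e] by apply/existsP; exists v; rewrite vV.
  by rewrite andbT.
exists H; split => //.
  apply: (@leq_trans (\sum_(v in V) degree v H)).
    under eq_bigr => v _ do rewrite /degree -sum1dep_card big_mkcondr /=.
    rewrite exchange_big /= -sum1_card; apply: leq_sum => e; rewrite inE.
    move=> /andP[_ /existsP[v /andP[vV ve]]].
    by rewrite (bigD1 v) //= ve.
  rewrite (eq_bigr (fun=> n.-1)) //.
  by rewrite sum_nat_const cV leq_mul2l leq_pred orbT.
rewrite star_countE // (bigID (mem V)) /=; apply: leq_trans (leq_addr _ _).
rewrite (eq_bigr (fun=> 'C(n.-1, r))); last by move=> v /dH ->.
by rewrite sum_nat_const cV.
Qed.

(** Holds down to n = r + 1 because n <= (r + 1) (n - r) whenever n > r. *)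
Lemma max_pow_le_bin (R : realType) (r n : nat) : (r < n)%N ->
  n%:R ^+ r <= r.+1%:R ^+ r * r`!%:R * 'C(n.-1, r)%:R :> R.
Proof.
move=> rn; rewrite -!natrX -!natrM ler_nat -mulnA [(r`! * _)%N]mulnC bin_ffact.
apply: (@leq_trans ((r.+1 * (n - r)) ^ r)).
  case: r rn => // r rn; rewrite leq_exp2r //.
  have : (r.+1 <= r.+1 * (n - r.+1))%N by rewrite leq_pmulr // subn_gt0.
  by move=> h; rewrite -{1}(subnK (ltnW rn)) mulSn leq_add2l.
rewrite expnMn leq_mul2l; apply/orP; right.
by case: n rn => // n _; exact: expn_le_ffact.
Qed.

(** Let y = (1 + eps) mu. If y <= C(n - 1, r), one star of least sufficient size has O(rho) edges.
    Otherwise the least sufficient number k of full vertices is O(mu / n^r), at a cost of at most k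
    n edges. *)
Lemma plant_edges_le (R : realType) (r : nat) (eps : R) :
  (2 <= r)%N -> 0 < eps ->
  exists2 C : R, 0 < C &
  forall (n : nat) (p rho : R), (r < n)%N -> 0 < p ->
    1 <= (1 + eps) * star_mean r n p -> 0 < rho -> rho ^+ r = star_mean r n p ->
    (1 + eps) * star_mean r n p <= (n * 'C(n.-1, r))%:R ->
    exists H : {set {set 'I_n}}, [/\ H \subset complete_graph 'I_n,
      (1 + eps) * star_mean r n p <= (star_count r H)%:R &
      #|H|%:R <= C * Num.max rho (rho ^+ r / n%:R ^+ r.-1)].
Proof.
move=> r2 eps0; have r0 : (0 < r)%N by rewrite ltnW.
have rR : 0 < r%:R :> R by rewrite ltr0n.
pose W : R := r.+1%:R ^+ r * r`!%:R.
have W0 : 0 < W by rewrite mulr_gt0 ?exprn_gt0 // ltr0n fact_gt0.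
pose C := Num.max (2 * r%:R * (1 + eps)) (2 * W * (1 + eps)).
have C0 : 0 < 2 * r%:R * (1 + eps) by rewrite !mulr_gt0 //; lra.
exists C; first by rewrite lt_max C0.
move=> n p rho rn p0; set mu := star_mean r n p => mu1 rho0 rhoE muX.
have n0 : (0 < n)%N by apply: leq_ltn_trans rn.
have nR : 0 < n%:R :> R by rewrite ltr0n.
set y := (1 + eps) * mu in mu1 muX *.
set M := Num.max _ _.
have M0 : 0 <= M by rewrite le_max ltW.
have c0 : 0 < 'C(n.-1, r)%:R :> R by rewrite ltr0n bin_gt0; case: (n) rn.
have [yc|cy] := leP y 'C(n.-1, r)%:R.
  have exs : exists s, y <= 'C(s, r)%:R by exists n.-1.
  have [s ys smin] := ex_minnP exs.
  have sn : (s <= n.-1)%N by apply: smin.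
  have [H [HK cH sH]] := exists_star_graph r2 n0 sn.
  exists H; split => //; first by apply: le_trans ys _; rewrite ler_nat.
  have s0 : (0 < s)%N.
    by move: ys; case: (s) => //; rewrite bin0n (gtn_eqF r0) => /(le_trans mu1); rewrite ler10.
  have ys1 : 'C(s.-1, r)%:R <= y.
    rewrite leNgt; apply/negP => /ltW /smin; by rewrite -{1}(prednK s0) ltnn.
  have rhoge : 1 <= (1 + eps) * rho by apply: root_ge1 r0 eps0 rho0 _; rewrite rhoE.
  pose sig := (1 + eps) * rho.
  have sigr : y <= sig ^+ r.
    rewrite /y -rhoE exprMn; apply: ler_wpM2r; first by rewrite exprn_ge0 // ltW.
    by rewrite -[X in X <= _]expr1; apply: ler_weXn2l => //; lra.
  (* Minimality gives C(s - 1, r) <= y, so s - r = O(rho); the additive r is O(rho) too, since (1 +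
     eps) rho >= 1. *)
  have : ((s - r)%:R : R) ^+ r <= (r%:R * sig) ^+ r.
    apply: (@le_trans _ _ (r`!%:R * 'C(s.-1, r)%:R)).
      rewrite -natrX -natrM ler_nat mulnC bin_ffact.
      by rewrite -{1}(prednK s0) expn_le_ffact.
    rewrite exprMn; apply: ler_pM => //; last exact: le_trans sigr.
    by rewrite -natrX ler_nat fact_le_expn.
  have sig0 : 0 < sig by rewrite mulr_gt0 //; lra.
  rewrite ler_pXn2r ?nnegrE //; last by rewrite mulr_ge0 // ltW.
  move=> srsig; have sle : s%:R <= (s - r)%:R + r%:R :> R.
    by rewrite -natrD ler_nat addnC -leq_subLR.
  apply: (@le_trans _ _ (2 * r%:R * (1 + eps) * rho)).
    rewrite cH; apply: le_trans sle _.
    have : r%:R <= r%:R * sig by rewrite ler_peMr // ltW.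
    move: srsig; rewrite /sig; set z := (s - r)%:R; set t := _ * (_ * rho).
    rewrite (_ : 2 * r%:R * (1 + eps) * rho = 2 * t); last by rewrite /t; ring.
    by move: t z => t z; lra.
  apply: ler_pM; rewrite ?(ltW C0) ?(ltW rho0) // /C le_max lexx //.
have exk : exists k, y <= (k * 'C(n.-1, r))%:R by exists n.
have [k yk kmin] := ex_minnP exk.
have kn : (k <= n)%N by apply: kmin.
have [H [HK cH sH]] := exists_full_vertices_graph r2 kn.
exists H; split => //; first by apply: le_trans yk _; rewrite ler_nat.
have k0 : (0 < k)%N.
  by move: yk; case: (k) => //; rewrite mul0n => /(le_trans mu1); rewrite ler10.
have yk1 : (k.-1 * 'C(n.-1, r))%:R <= y.
  by rewrite leNgt; apply/negP => /ltW /kmin; rewrite -{1}(prednK k0) ltnn.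
(* Rounding k up costs at most one more C(n - 1, r), which is below y here. *)
have kc : (k%:R : R) * 'C(n.-1, r)%:R <= 2 * y.
  rewrite -(prednK k0) -natr1 mulrDl mul1r -natrM.
  by move: yk1 cy; set a := _%:R; set b := _%:R; lra.
apply: (@le_trans _ _ (2 * W * (1 + eps) * (rho ^+ r / n%:R ^+ r.-1))); last first.
  apply: ler_pM; rewrite ?divr_ge0 ?exprn_ge0 ?(ltW rho0) ?(ltW nR) //.
  - by apply: mulr_ge0; [apply: mulr_ge0 => //; exact: ltW|lra].
  - by rewrite /C le_max lexx orbT.
  - by rewrite le_max lexx orbT.
rewrite mulrA ler_pdivlMr ?exprn_gt0 //.
apply: (@le_trans _ _ (k%:R * n%:R ^+ r)).
  rewrite -[X in _ <= _ * _ ^+ X](prednK r0) exprS mulrA; apply: ler_wpM2r.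
    by rewrite exprn_ge0 // ltW.
  by rewrite -natrM ler_nat.
apply: (@le_trans _ _ (k%:R * (W * 'C(n.-1, r)%:R))).
  by apply: ler_wpM2l => //; exact: max_pow_le_bin.
rewrite mulrCA; apply: (@le_trans _ _ (W * (2 * y))).
  by apply: ler_wpM2l => //; exact: ltW.
rewrite /y -rhoE le_eqVlt; apply/orP; left; apply/eqP; by ring.
Qed.

(** * The sparse regime: many vertices with a few edges each *)

Lemma expR_le_1B (R : realType) (x : R) :
  0 <= x -> x <= 2^-1 -> expR (- (2 * x)) <= 1 - x.
Proof.
move=> x0 x1; rewrite expRN -[X in X <= _]mul1r ler_pdivrMr ?expR_gt0 //.
apply: (@le_trans _ _ ((1 - x) * (1 + 2 * x))); first by nra.
by apply: ler_wpM2l; [lra|exact: expR_ge1Dx].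
Qed.

Lemma card_ord_lt (n N : nat) :
  (N <= n)%N -> #|[set v : 'I_n | (v < N)%N]| = N.
Proof.
move=> Nn; have winj : injective (widen_ord Nn).
  by move=> i j /(congr1 val) /= ij; apply: val_inj.
rewrite -[RHS](card_ord N) -(card_imset predT winj).
apply: eq_card => v; rewrite inE; apply/idP/imsetP => [vk|[i _ ->]] /=.
  by exists (Ordinal vk) => //; apply: val_inj.
exact: ltn_ord.
Qed.

Lemma big_option (R : realType) (I : finType) (F : option I -> R) :
  \prod_i F i = F None * \prod_i F (Some i).
Proof.
rewrite (bigD1 None) //=; congr (_ * _).
rewrite (reindex_omap Some id) /=; last by case.
by apply: eq_bigl => i; rewrite eqxx.
Qed.

(* Assigning every edge to at most one endpoint makes the numbers of assigned
   edges independent. An edge inside the first N vertices goes to an unspecified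
   endpoint; only the edges leaving them are needed. *)
Definition low_end (n N : nat) (e : {set 'I_n}) : option 'I_n :=
  [pick v in e | (v < N)%N].

Definition own_degree (n N : nat) (v : option 'I_n) (G : {set {set 'I_n}}) : nat :=
  #|[set e in G | low_end N e == v]|.

Lemma own_degree_le (n N : nat) (v : 'I_n) (G : {set {set 'I_n}}) :
  (own_degree N (Some v) G <= degree v G)%N.
Proof.
apply/subset_leq_card/subsetP => e; rewrite !inE => /andP[-> /=].
by rewrite /low_end; case: pickP => // u /andP[ue _] /eqP[<-].
Qed.

(** An edge from v to a vertex outside the first N has v as its only low endpoint, so it is assigned
    to v. *)
Lemma own_degree_complete (n N : nat) (v : 'I_n) :
  (N <= n)%N -> (v < N)%N -> (n - N <= own_degree N (Some v) (complete_graph 'I_n))%N.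
Proof.
move=> Nn vN; pose W := [set w : 'I_n | (N <= w)%N].
have vW w : w \in W -> w != v.
  by rewrite inE => Nw; apply: contraTneq vN => <-; rewrite -leqNgt.
have cW : #|W| = (n - N)%N.
  have -> : W = ~: [set w : 'I_n | (w < N)%N].
    by apply/setP => w; rewrite !inE leqNgt.
  by rewrite -[n in RHS]card_ord -(cardsC [set w : 'I_n | (w < N)%N]) card_ord_lt // addKn.
have <- : #|[set [set v; w] | w in W]| = (n - N)%N.
  by rewrite card_in_imset // => w w' /vW wv _; exact: set2_injr.
apply/subset_leq_card/subsetP => e /imsetP[w wW ->]; rewrite !inE.
rewrite cards2 [v == w]eq_sym (vW _ wW) /=.
rewrite /low_end; case: pickP => [u|/(_ v)]; last by rewrite !inE eqxx vN.
rewrite !inE => /andP[/orP[]/eqP -> // wN].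
by move: wW; rewrite inE leqNgt wN.
Qed.

(** For a t-set T of low vertices, consider the event that exactly the members of T own at least r
    edges. These events are disjoint, have product probabilities, and each yields at least t
    stars. *)
Lemma sparse_tail_ge (R : realType) (r n N t : nat) (p q Q y : R) :
  (2 <= r)%N -> 0 <= p -> p <= 1 -> (N <= n)%N -> y <= t%:R -> 0 <= q -> 0 <= Q -> Q <= 1 ->
  (forall k, (n - N <= k <= n.-1)%N ->
     q <= bin_mean p k (fun j => (r <= j)%N%:R) <= Q) ->
  'C(N, t)%:R * (q ^+ t * (1 - Q) ^+ N) <=
  gnp_prob p (fun G : {set {set 'I_n}} => y <= (star_count r G)%:R).
Proof.
move=> r2 p0 p1 Nn yt q0 Q0 Q1 qQ.
pose V := [set v : 'I_n | (v < N)%N].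
have cV : #|V| = N. exact: card_ord_lt.
pose good G := [set v in V | (r <= own_degree N (Some v) G)%N].
(* The indicator of [good G = T] as a product over owners; high vertices and unassigned edges get
   the factor 1. *)
pose h (T : {set 'I_n}) (i : option 'I_n) (j : nat) : R :=
  if i is Some v then (if v \in V then ((v \in T) == (r <= j)%N)%:R else 1) else 1.
have hE (T G : {set _}) : T \subset V ->
    \prod_i h T i (own_degree N i G) = (T == good G)%:R.
  move=> TV; case: eqP => [->|/eqP neT].
    apply: big1 => -[v|] //= _; case vV: (v \in V) => //.
    by rewrite inE vV eqxx.
  have [v nev] : exists v, (v \in T) != (v \in good G).
    by apply/existsP; apply: contraNT neT => /existsPn h0; apply/eqP/setP => v;
       apply/eqP; have := h0 v; rewrite negbK.
  have vV : v \in V.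
    by apply: contraNT nev => vV; rewrite (contraNF (subsetP TV v) vV) inE (negPf vV).
  rewrite (bigD1 (Some v)) //= vV; move: nev; rewrite inE vV /= => /negPf ->.
  by rewrite mul0r.
pose S := [set T : {set 'I_n} | T \subset V & #|T| == t].
rewrite gnp_probE.
apply: (@le_trans _ _ (subset_mean p (complete_graph 'I_n)
    (fun G => \sum_(T in S) \prod_i h T i (own_degree N i G)))); last first.
  apply: subset_mean_le => // G GK.
  rewrite (eq_bigr (fun T => (T == good G)%:R)); last first.
    by move=> T; rewrite inE => /andP[TV _]; exact: hE.
  have [gS|gS] := boolP (good G \in S); last first.
    rewrite big1 // => T TS; case: eqP => // eT; by rewrite -eT TS in gS.
  rewrite (bigD1 (good G)) //= eqxx big1 ?addr0; last by move=> T /andP[_ /negPf ->].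
  suff -> : y <= (star_count r G)%:R by [].
  apply: le_trans yt _; rewrite ler_nat star_countE // (bigID (mem (good G))) /=.
  apply: leq_trans (leq_addr _ _).
  move: gS; rewrite inE => /andP[_ /eqP <-]; rewrite -sum1_card; apply: leq_sum => v.
  rewrite inE => /andP[_ rv]; rewrite bin_gt0; apply: leq_trans rv _.
  exact: own_degree_le.
rewrite subset_mean_sum.
have -> : 'C(N, t)%:R = (\sum_(T in S) 1 : R).
  by rewrite sumr_const cards_draws cV.
rewrite mulr_suml; apply: ler_sum => T; rewrite inE mul1r => /andP[TV /eqP cT].
have -> := subset_mean_prod_owner p (@low_end n N) (h T) (complete_graph 'I_n).
rewrite big_option /h /= bin_mean_cst mul1r (bigID (mem V)) /= [X in _ <= X]mulrC big1 ?mul1r; last first.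
  by move=> v /negPf ->; rewrite bin_mean_cst.
pose f v := bin_mean p #|[set e in complete_graph 'I_n | low_end N e == Some v]|
  (fun j => (r <= j)%N%:R).
have qv v : v \in V -> q <= f v <= Q.
  move=> vV; apply: qQ; rewrite own_degree_complete //; last by move: vV; rewrite inE.
  by rewrite -(degree_complete v) own_degree_le.
rewrite (bigID (mem T)) /=; apply: ler_pM; rewrite ?exprn_ge0 ?subr_ge0 //.
  rewrite (eq_bigl (mem T)); last first.
    by move=> v /=; case vT: (v \in T); rewrite ?andbF ?andbT // (subsetP TV).
  rewrite (eq_bigr f); last first.
    move=> v vT'; have vT : v \in T := vT'.
    rewrite (subsetP TV) // vT; apply: eq_bin_mean => j.
    by case: (r <= j)%N.
  rewrite -cT -prodr_const; apply: ler_prod => v vT.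
  by rewrite q0; case/andP: (qv v (subsetP TV v vT)).
rewrite (eq_bigr (fun v => 1 - f v)); last first.
  move=> v /andP[vV /negPf vT]; rewrite vV vT.
  rewrite -[1 in RHS](bin_mean_cst p #|[set e in complete_graph 'I_n | low_end N e == Some v]|).
  rewrite -mulN1r -bin_meanZ -bin_meanD; apply: eq_bin_mean => j.
  by case: (r <= j)%N; rewrite /= ?mulr1 ?mulr0 ?subrr ?addr0.
(* Fewer than N vertices may lie outside T; surplus factors 1 - Q <= 1 only lower the bound. *)
apply: (@le_trans _ _ (\prod_(v | (v \in V) && (v \notin T)) (1 - Q))).
  rewrite prodr_const; apply: ler_wiXn2l; rewrite ?subr_ge0 //.
    by rewrite gerBl.
  by rewrite -cV; apply/subset_leq_card/subsetP => v /andP[].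
apply: ler_prod => v /andP[vV _]; rewrite subr_ge0 Q1 lerD2l lerN2.
by case/andP: (qv v vV).
Qed.

(** Applied both to the fixed r and to the growing number t of chosen vertices, hence the explicit
    dependence on r. *)
Lemma pow_le_bin4 (k r n : nat) :
  (n <= 4 * (k.+1 - r))%N -> (n ^ r <= 4 ^ r * r`! * 'C(k, r))%N.
Proof.
move=> h; rewrite -mulnA [(r`! * _)%N]mulnC bin_ffact.
apply: (@leq_trans ((4 * (k.+1 - r)) ^ r)).
  by case: (r) h => // r' h; rewrite leq_exp2r.
by rewrite expnMn leq_mul2l expn_le_ffact orbT.
Qed.

Lemma half_window (r n k : nat) :
  (4 * r <= n)%N -> (n - n./2 <= k)%N -> (n <= 4 * (k.+1 - r))%N.
Proof. lia. Qed.

Lemma half_window_sub (n t : nat) :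
  (4 * t <= n)%N -> (n <= 4 * (n./2.+1 - t))%N.
Proof. lia. Qed.

Lemma half_le_self (n : nat) : (n./2 <= n)%N.
Proof. lia. Qed.

(** Keeps only the event of exactly r successes, evaluated by size biasing the indicator of j = r;
    (1 - p)^n >= e^(-2) because n p <= 1. *)
Lemma exactly_r_ge (R : realType) (r n k : nat) (p : R) :
  (2 <= r)%N -> 0 <= p -> (4 * r <= n)%N -> n%:R * p <= 1 ->
  (n - n./2 <= k <= n.-1)%N ->
  (n%:R * p) ^+ r * (expR (- 2) / (4 ^ r * r`!)%:R) <=
  bin_mean p k (fun j => (r <= j)%N%:R).
Proof.
move=> r2 p0 n4r np1 /andP[nk kn].
have n2 : (2 <= n)%N.
  apply: leq_trans n4r; apply: leq_trans r2 _; by rewrite leq_pmull.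
have n0 : (0 < n)%N by apply: leq_trans n2.
have nR : 0 < n%:R :> R by rewrite ltr0n.
have p2 : p <= 2^-1.
  have : (2%:R : R) * p <= n%:R * p by apply: ler_wpM2r => //; rewrite ler_nat.
  by lra.
have p1 : p <= 1 by lra.
apply: (@le_trans _ _ (bin_mean p k (fun j => 'C(j, r)%:R * (j == r)%:R))); last first.
  apply: bin_mean_le => // j _; case: eqP => [->|_].
    by rewrite binn leqnn mulr1.
  by rewrite mulr0.
rewrite (bin_mean_binM p r k (fun j => (j == r)%:R)).
rewrite (eq_bin_mean _ _ (h2 := fun j => (j == 0%N)%:R)); last first.
  by move=> j; rewrite -{2}(add0n r) eqn_add2r.
rewrite bin_mean_eq0 exprMn.
have q0 : 0 <= 1 - p by lra.
have le1 : expR (- 2) <= (1 - p) ^+ (k - r).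
  apply: (@le_trans _ _ ((1 - p) ^+ n)); last first.
    apply: ler_wiXn2l; [by []|by lra|].
    by apply: leq_trans (leq_subr _ _) _; apply: leq_trans kn _; exact: leq_pred.
  apply: (@le_trans _ _ (expR (- (2 * p)) ^+ n)).
    by rewrite -expRM_natl ler_expR; lra.
  by apply: lerXn2r; rewrite ?nnegrE ?expR_ge0 //; exact: expR_le_1B.
have f0 : 0 < (4 ^ r * r`!)%:R :> R by rewrite ltr0n muln_gt0 expn_gt0 fact_gt0.
have le2 : n%:R ^+ r / (4 ^ r * r`!)%:R <= 'C(k, r)%:R :> R.
  rewrite ler_pdivrMr // mulrC -natrX -natrM ler_nat.
  by apply: pow_le_bin4; exact: half_window.
rewrite mulrA [X in X <= _](_ : _ =
   n%:R ^+ r / (4 ^ r * r`!)%:R * p ^+ r * expR (- 2)); last first.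
  by move: (n%:R ^+ r) (p ^+ r) (expR _) (_^-1) => a b c d; ring.
apply: ler_pM => //; rewrite ?expR_ge0 //.
  by rewrite !mulr_ge0 ?invr_ge0 ?exprn_ge0.
by apply: ler_wpM2r => //; exact: exprn_ge0.
Qed.

(** A first moment bound, since C(j, r) >= 1 for j >= r. *)
Lemma at_least_r_le (R : realType) (r n k : nat) (p : R) :
  (2 <= r)%N -> 0 <= p -> p <= 1 -> (k <= n)%N ->
  bin_mean p k (fun j => (r <= j)%N%:R) <= (n%:R * p) ^+ r / 2.
Proof.
move=> r2 p0 p1 kn; apply: (@le_trans _ _ (bin_mean p k (fun j => 'C(j, r)%:R))).
  apply: bin_mean_le => // j _; rewrite ler_nat.
  by case rj: (r <= j)%N => //=; rewrite bin_gt0.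
rewrite bin_mean_bin exprMn mulrAC; apply: ler_wpM2r; first exact: exprn_ge0.
rewrite ler_pdivlMr // mulrC; apply: le_trans (bin_le_half_pow R k r2) _.
by apply: lerXn2r; rewrite ?nnegrE ?ler0n // ler_nat.
Qed.

(** Take N = n / 2, rounded down, and x = (n p)^r, which is of order mu / n. Then C(N, t) q^t >= (n
    q / (4 t))^t >= kap^t and (1 - x / 2)^N >= e^(-n x); both are exp(-O(mu)). *)
Lemma sparse_tail_exp (R : realType) (r : nat) (eps : R) :
  (2 <= r)%N -> 0 < eps ->
  exists2 C : R, 0 < C &
  forall (n t : nat) (p y : R), 0 < p -> (4 * r <= n)%N -> n%:R * p <= 1 ->
    (0 < t)%N -> (4 * t <= n)%N -> y <= t%:R ->
    t%:R <= 2 * ((1 + eps) * star_mean r n p) ->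
    expR (- (C * star_mean r n p)) <=
    gnp_prob p (fun G : {set {set 'I_n}} => y <= (star_count r G)%:R).
Proof.
move=> r2 eps0; have r0 : (0 < r)%N by rewrite ltnW.
pose q0 : R := expR (- 2) / (4 ^ r * r`!)%:R.
have f0 : 0 < (4 ^ r * r`!)%:R :> R by rewrite ltr0n muln_gt0 expn_gt0 fact_gt0.
have q00 : 0 < q0 by rewrite divr_gt0 // expR_gt0.
have q01 : q0 <= 1.
  rewrite ler_pdivrMr // mul1r; apply: (@le_trans _ _ 1).
    by rewrite expR_le1; lra.
  by rewrite ler1n muln_gt0 expn_gt0 fact_gt0.
(* The value of n x q0 / (4 t) at t = 2 (1 + eps) n x, an upper bound for t. *)
pose kap := q0 / (8 * (1 + eps)).
have e80 : 0 < 8 * (1 + eps) by lra.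
have kap0 : 0 < kap by rewrite divr_gt0.
have kap1 : kap <= 1 by rewrite ler_pdivrMr // mul1r; lra.
pose W : R := r.+1%:R ^+ r * r`!%:R.
have W0 : 0 < W by rewrite mulr_gt0 ?exprn_gt0 // ltr0n fact_gt0.
have lk : 0 <= - ln kap by rewrite oppr_ge0 ln_le0.
exists (2 * (1 + eps) * - ln kap + W).
  by apply: ltr_wpDl => //; apply: mulr_ge0 => //; lra.
move=> n t p y p0 n4r np1 t0 t4 yt tmu.
have n0 : (0 < n)%N by apply: leq_trans n4r; rewrite muln_gt0.
have rn : (r < n)%N by apply: leq_trans n4r; rewrite -[X in (X < _)%N]mul1n ltn_pmul2r.
have nR : 0 < n%:R :> R by rewrite ltr0n.
have n1 : 1 <= n%:R :> R by rewrite ler1n.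
have p1 : p <= 1 by apply: le_trans np1; rewrite ler_peMl // ltW.
pose x := (n%:R * p) ^+ r.
have x0 : 0 < x by rewrite exprn_gt0 // mulr_gt0.
have x1 : x <= 1 by rewrite exprn_ile1 // mulr_ge0 // ltW.
have nx : n%:R * x <= W * star_mean r n p.
  rewrite star_meanE // mulrCA; apply: ler_wpM2l; first exact: ltW.
  rewrite /x exprMn mulrA; apply: ler_wpM2r; first by rewrite exprn_ge0 // ltW.
  exact: max_pow_le_bin.
have mux : star_mean r n p <= n%:R * x.
  apply: le_trans (star_mean_le n r2 (ltW p0)) _.
  by rewrite /x exprMn exprS mulrA.
have xq0 : 0 < x * q0 by exact: mulr_gt0.
have h := @sparse_tail_ge R r n n./2 t p (x * q0) (x / 2) y r2 (ltW p0) p1.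
apply: le_trans (h _ yt (ltW xq0) _ _ _); last first.
- move=> k kn; rewrite exactly_r_ge ?(ltW p0) //=.
  apply: at_least_r_le => //; first exact: ltW.
  by case/andP: kn => _ kn; apply: leq_trans kn (leq_pred _).
- by lra.
- by lra.
- exact: half_le_self.
rewrite mulrA mulrDl opprD expRD; apply: ler_pM; rewrite ?expR_ge0 //.
  apply: (@le_trans _ _ (kap ^+ t)).
    rewrite -[X in _ <= X ^+ _](@lnK R) ?posrE // -expRM_natl ler_expR.
    have : - ln kap * t%:R <= - ln kap * (2 * ((1 + eps) * star_mean r n p)).
      exact: ler_wpM2l.
    by set a := ln kap; set b := star_mean _ _ _; lra.
  have tR : 0 < t%:R :> R by rewrite ltr0n.
  have t4R : 0 < (4 * t%:R) ^+ t :> R by rewrite exprn_gt0 // mulr_gt0.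
  rewrite -(ler_pM2l t4R) -exprMn.
  have le1 : (n%:R : R) ^+ t <= (4 * t%:R) ^+ t * 'C(n./2, t)%:R.
    rewrite -natrM -!natrX -natrM ler_nat expnMn.
    apply: leq_trans (pow_le_bin4 (half_window_sub t4)) _.
    by rewrite leq_mul2r leq_mul2l fact_le_expn !orbT.
  rewrite [X in _ <= X]mulrA.
  apply: (@le_trans _ _ (n%:R ^+ t * (x * q0) ^+ t)); last first.
    by apply: ler_wpM2r => //; rewrite exprn_ge0 // ltW.
  rewrite -exprMn; apply: lerXn2r.
  - by rewrite nnegrE; apply: mulr_ge0; [exact: mulr_ge0|exact: ltW].
  - by rewrite nnegrE; apply: mulr_ge0 => //; exact: ltW.
  have le2 : t%:R <= 2 * (1 + eps) * (n%:R * x).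
    apply: le_trans tmu _; rewrite mulrA; apply: ler_wpM2l => //; lra.
  have kapE (a b c : R) : 0 < c -> 4 * a * (b / (8 * c)) = a / (2 * c) * b.
    by move=> c0; field; rewrite gt_eqF.
  rewrite /kap kapE; last by lra.
  rewrite [X in _ <= X]mulrA; apply: ler_wpM2r; first exact: ltW.
  by rewrite ler_pdivrMr; [rewrite [X in _ <= X]mulrC|lra].
apply: (@le_trans _ _ (expR (- (n%:R * x)))); first by rewrite ler_expR lerN2.
apply: (@le_trans _ _ (expR (- (2 * (x / 2))) ^+ n./2)).
  rewrite -expRM_natl ler_expR mulrN lerN2 [2 * (x / 2)]mulrCA divff ?mulr1 ?pnatr_eq0 //.
  apply: ler_wpM2r; first exact: ltW.
  by rewrite ler_nat half_le_self.
apply: lerXn2r; rewrite ?nnegrE ?expR_ge0 //; first by lra.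
by apply: expR_le_1B; lra.
Qed.

(** * The dense regime and the combined lower bound *)

Lemma ln_le_2sqrt (R : realType) (n : nat) :
  (0 < n)%N -> ln (n%:R : R) <= 2 * Num.sqrt n%:R.
Proof.
move=> n0; have nR : 0 < n%:R :> R by rewrite ltr0n.
have s0 : 0 < Num.sqrt n%:R :> R by rewrite sqrtr_gt0.
have := lnXn 2 s0; rewrite sqr_sqrtr ?(ltW nR) // -[ln _ *+ 2]mulr_natl => ->.
by apply: ler_wpM2l => //; exact: ltW (ln_sublinear s0).
Qed.

(* Once mu is at least of order n, the planted lower bound is the better one. *)
Lemma dense_rate_le (R : realType) (r : nat) (eps D : R) :
  (2 <= r)%N -> 0 < eps -> 0 < D ->
  exists2 E : R, 0 < E &
  forall (n : nat) (p rho : R), (r < n)%N -> 0 < p -> p <= 1 ->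
    1 <= (1 + eps) * star_mean r n p -> 0 < rho -> rho ^+ r = star_mean r n p ->
    n%:R <= D * ((1 + eps) * star_mean r n p) ->
    Num.max rho (rho ^+ r / n%:R ^+ r.-1) * ln (p^-1) <= E * star_mean r n p.
Proof.
move=> r2 eps0 D0; have r0 : (0 < r)%N by rewrite ltnW.
have rR1 : 1 <= r%:R :> R by rewrite ler1n.
have leps : 0 <= ln (1 + eps) by rewrite ln_ge0 //; lra.
pose a : R := ln (1 + eps) + 2 * r.+1%:R.
have a0 : 0 < a by apply: ltr_wpDl => //; rewrite mulr_gt0.
pose S := Num.sqrt D * (1 + eps) ^+ r.-1.
have S0 : 0 <= S by rewrite mulr_ge0 ?sqrtr_ge0 // exprn_ge0 //; lra.
exists (a * (1 + S)); first by rewrite mulr_gt0 //; lra.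
move=> n p rho rn p0 p1 mu1 rho0 rhoE nD.
have n0 : (0 < n)%N by apply: leq_ltn_trans rn.
have nR : 1 <= n%:R :> R by rewrite ler1n.
have nR0 : 0 < n%:R :> R by rewrite ltr0n.
have mu0 : 0 <= star_mean r n p by rewrite -rhoE exprn_ge0 // ltW.
have lnp0 : 0 <= ln (p^-1) by rewrite ln_ge0 // invf_ge1.
have sq1 : 1 <= Num.sqrt n%:R :> R by rewrite -[X in X <= _]sqrtr1 ler_sqrt // ltW.
have lnp : ln (p^-1) <= a * Num.sqrt n%:R.
  apply: (@le_trans _ _ (r%:R * ln (p^-1))); first by rewrite ler_peMl.
  apply: le_trans (ln_inv_p_le r2 n0 p0 eps0 mu1) _.
  rewrite /a mulrDl; apply: lerD; first by rewrite ler_peMr.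
  by rewrite [2 * _]mulrC -mulrA; apply: ler_wpM2l => //; exact: ln_le_2sqrt.
have sqn : Num.sqrt n%:R <= n%:R :> R.
  by rewrite -[X in _ <= X](sqr_sqrtr (ltW nR0)) expr2 ler_peMr // ?sqrtr_ge0.
pose sig := (1 + eps) * rho.
have sig1 : 1 <= sig by apply: root_ge1 r0 eps0 rho0 _; rewrite rhoE.
have sig0 : 0 <= sig by lra.
(* As r <= 2 (r - 1), sqrt y <= sig^(r-1) for y = (1 + eps) mu; with n = O(y) this gives sqrt n =
   O(rho^(r-1)), which beats ln(1/p) = O(sqrt n). *)
have ysig : (1 + eps) * star_mean r n p <= (sig ^+ r.-1) ^+ 2.
  apply: (@le_trans _ _ (sig ^+ r)).
    rewrite /sig exprMn -rhoE; apply: ler_wpM2r; first by rewrite exprn_ge0 // ltW.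
    by rewrite -[X in X <= _]expr1; apply: ler_weXn2l => //; lra.
  rewrite -exprM; apply: ler_weXn2l => //.
  by case: (r) r2 => [|[|k]] // _; rewrite /= muln2 -addnn addSn ltnS leq_addl.
have sqS : Num.sqrt n%:R <= S * rho ^+ r.-1.
  apply: (@le_trans _ _ (Num.sqrt (D * (sig ^+ r.-1) ^+ 2))).
    rewrite ler_sqrt; last by rewrite mulr_ge0 ?sqr_ge0 // ltW.
    by apply: le_trans nD _; apply: ler_wpM2l => //; exact: ltW.
  rewrite sqrtrM ?(ltW D0) // sqrtr_sqr ger0_norm ?exprn_ge0 //.
  by rewrite /S /sig exprMn mulrA.
have rhor : rho * rho ^+ r.-1 = star_mean r n p by rewrite -exprS prednK.
have M1 : rho * ln (p^-1) <= a * S * star_mean r n p.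
  apply: (@le_trans _ _ (rho * (a * (S * rho ^+ r.-1)))).
    apply: ler_wpM2l; first exact: ltW.
    by apply: le_trans lnp _; apply: ler_wpM2l => //; exact: ltW.
  by rewrite -rhor le_eqVlt; apply/orP; left; apply/eqP; ring.
have M2 : rho ^+ r / n%:R ^+ r.-1 * ln (p^-1) <= a * star_mean r n p.
  rewrite rhoE mulrAC ler_pdivrMr ?exprn_gt0 // [a * _]mulrC -mulrA.
  apply: ler_wpM2l => //; apply: le_trans lnp _; apply: ler_wpM2l; first exact: ltW.
  apply: le_trans sqn _; rewrite -[X in X <= _]expr1; apply: ler_weXn2l => //.
  by case: (r) r2 => [|[]].
have aSmu : 0 <= a * S * star_mean r n p.
  by apply: mulr_ge0 => //; apply: mulr_ge0 => //; exact: ltW.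
have amu : 0 <= a * star_mean r n p by apply: mulr_ge0 => //; exact: ltW.
rewrite (_ : a * (1 + S) * _ = a * star_mean r n p + a * S * star_mean r n p); last by ring.
have [h|h] := leP rho (rho ^+ r / n%:R ^+ r.-1).
  by apply: le_trans M2 _; rewrite lerDl.
by apply: le_trans M1 _; rewrite lerDr.
Qed.

Lemma nat_ceil (R : realType) (y : R) :
  1 <= y -> exists t : nat, [/\ (0 < t)%N, y <= t%:R & t%:R <= 2 * y].
Proof.
move=> y1; have ext : exists t : nat, y <= t%:R.
  by exists (Num.bound y); apply/ltW/archi_boundP; lra.
have [t yt tmin] := ex_minnP ext.
have t0 : (0 < t)%N by rewrite -(ltr0n R); lra.
exists t; split=> //.
have : t.-1%:R <= y by rewrite leNgt; apply/negP => /ltW/tmin; rewrite -{1}(prednK t0) ltnn.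
by rewrite -{2}(prednK t0) -natr1; lra.
Qed.

Lemma upper_tail_prob_ge (R : realType) (r : nat) (eps : R) :
  (2 <= r)%N -> 0 < eps ->
  exists2 C : R, 0 < C &
  forall (n : nat) (p rho : R), (r < n)%N -> 0 < p -> p <= 1 ->
    1 <= (1 + eps) * star_mean r n p -> 0 < rho -> rho ^+ r = star_mean r n p ->
    (1 + eps) * star_mean r n p <= (n * 'C(n.-1, r))%:R ->
    expR (- (C * tail_rate r n p rho)) <=
    gnp_prob p (fun G : {set {set 'I_n}} =>
      (1 + eps) * star_mean r n p <= (star_count r G)%:R).
Proof.
move=> r2 eps0; have r0 : (0 < r)%N by rewrite ltnW.
have [C1 C10 plant] := plant_edges_le r2 eps0.
have [C2 C20 sparse] := sparse_tail_exp r2 eps0.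
pose W : R := r.+1%:R ^+ r * r`!%:R.
have W0 : 0 < W by rewrite mulr_gt0 ?exprn_gt0 // ltr0n fact_gt0.
(* The summands match the three ways to leave the sparse regime: n < 4 r, n p > 1, and n < 4 t <= 8
   y. *)
pose D := 4 * r%:R + W + 8.
have rR : 0 <= r%:R :> R by [].
have D0 : 0 < D by rewrite /D; lra.
have [E E0 dense] := dense_rate_le r2 eps0 D0.
pose C := C1 + C2 + C1 * E.
have CE0 : 0 < C1 * E by exact: mulr_gt0.
exists C; first by rewrite /C; lra.
move=> n p rho rn p0 p1 mu1 rho0 rhoE muX.
have n0 : (0 < n)%N by apply: leq_ltn_trans rn.
have lnp0 : 0 <= ln (p^-1) by rewrite ln_ge0 // invf_ge1.
have mu0 : 0 <= star_mean r n p by rewrite -rhoE exprn_ge0 // ltW.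
set tail := gnp_prob _ _.
set M := Num.max rho (rho ^+ r / n%:R ^+ r.-1) * ln (p^-1).
have M0 : 0 <= M by rewrite mulr_ge0 // le_max ltW.
have tailM : expR (- (C1 * M)) <= tail.
  have [H [HK Hmu cH]] := plant n p rho rn p0 mu1 rho0 rhoE muX.
  apply: le_trans (gnp_prob_plant r2 (ltW p0) p1 HK Hmu).
  rewrite -[X in X ^+ _](@lnK R) ?posrE // -expRM_natl ler_expR.
  have -> : ln p = - ln (p^-1) by rewrite lnV ?posrE // opprK.
  by rewrite mulrN lerN2 /M mulrA; apply: ler_wpM2r.
have tailmu : expR (- ((C2 + C1 * E) * star_mean r n p)) <= tail.
  have CEmu : 0 <= C1 * E * star_mean r n p by rewrite mulr_ge0 // ltW.
  have C2mu : 0 <= C2 * star_mean r n p by rewrite mulr_ge0 // ltW.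
  set y := (1 + eps) * star_mean r n p in mu1 *.
  have [t [t0 yt ty]] := nat_ceil mu1.
  have [sp|] := boolP [&& (4 * r <= n)%N, n%:R * p <= 1 & (4 * t <= n)%N].
    have /and3P[n4 np1 t4] := sp.
    apply: le_trans (sparse n t p y p0 n4 np1 t0 t4 yt ty).
    by rewrite ler_expR lerN2 mulrDl lerDl.
  rewrite !negb_and -!ltnNge -ltNge => nsp.
  have nD : n%:R <= D * y.
    have y0 : 0 <= y by lra.
    have Wy0 : 0 <= W * y by rewrite mulr_ge0 // ltW.
    have ry0 : r%:R <= r%:R * y by rewrite ler_peMr.
    have -> : D * y = 4 * (r%:R * y) + W * y + 8 * y by rewrite /D; ring.
    case/or3P: nsp => [n4r|np1|nt].
    - have : n%:R <= 4 * r%:R :> R by rewrite -natrM ler_nat ltnW.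
      by move: ry0 Wy0 y0; set z := r%:R * y; set w := W * y; lra.
    - have np : n%:R <= W * star_mean r n p.
        apply: (@le_trans _ _ (n%:R * (n%:R * p) ^+ r)).
          by rewrite ler_peMr // exprn_ege1 // ltW.
        rewrite star_meanE // mulrCA; apply: ler_wpM2l => //.
        rewrite exprMn mulrA; apply: ler_wpM2r; first by rewrite exprn_ge0 // ltW.
        exact: max_pow_le_bin.
      have : W * star_mean r n p <= W * y.
        by apply: ler_wpM2l; [exact: ltW|rewrite ler_peMl //; lra].
      by move: np ry0 rR y0; set z := r%:R * y; set w := W * y; lra.
    - have : n%:R <= 4 * t%:R :> R by rewrite -natrM ler_nat ltnW.
      by move: ty ry0 rR Wy0; set z := r%:R * y; set w := W * y; lra.
  (* Since n = O(y), planting costs no more than exp(-C1 E mu). *)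
  apply: le_trans tailM; rewrite ler_expR lerN2.
  apply: (@le_trans _ _ (C1 * (E * star_mean r n p))).
    by apply: ler_wpM2l; [exact: ltW|exact: dense].
  by rewrite mulrA mulrDl lerDr.
rewrite /tail_rate -/M rhoE.
have CM : C1 * M <= C * M.
  by apply: ler_wpM2r => //; rewrite /C; lra.
have Cmu : (C2 + C1 * E) * star_mean r n p <= C * star_mean r n p.
  by apply: ler_wpM2r => //; rewrite /C; lra.
have [_|_] := leP (star_mean r n p) M.
  by apply: le_trans tailmu; rewrite ler_expR lerN2.
by apply: le_trans tailM; rewrite ler_expR lerN2.
Qed.

Theorem theorem1 (R : realType) (r : nat) (hr : (2 <= r)%N)
    (eps : R) (heps : 0 < eps) :
  exists c C : R, [/\ 0 < c, 0 < C &
    forall (n : nat) (p : R), (1 <= n)%N -> 0 < p -> p <= 1 ->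
      let mu := star_mean r n p in
      let Phi := upper_tail_rate r n p in
      let tail := gnp_prob p (fun G : {set {set 'I_n}} =>
                    (1 + eps) * mu <= (star_count r G)%:R) in
      1 <= (1 + eps) * mu ->
      (1 + eps) * mu <= (star_count r (complete_graph 'I_n))%:R ->
      c * Phi <= - ln tail /\ - ln tail <= C * Phi].
Proof.
have [c c0 upper] := upper_tail_prob_le hr heps.
have [C C0 lower] := upper_tail_prob_ge hr heps.
exists c, C; split=> // n p n0 p0 p1 mu Phi tail mu1 muX.
have r0 : (0 < r)%N by rewrite ltnW.
rewrite star_count_complete // in muX.
(* A threshold of at least 1 that K_n can reach forces K_n to contain a star. *)
have rn : (r < n)%N.
  have : (0 < n * 'C(n.-1, r))%N by rewrite -(ltr0n R); apply: lt_le_trans muX; lra.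
  by rewrite muln_gt0 n0 bin_gt0 -ltnS prednK.
have mu0 : 0 < mu.
  by rewrite -(pmulr_rgt0 _ (_ : 0 < 1 + eps)); lra.
pose rho := mu `^ (r%:R^-1).
have rho0 : 0 < rho by exact: powR_gt0.
have rhoE : rho ^+ r = mu.
  rewrite /rho -powR_mulrn ?powR_ge0 // -powRrM mulVf ?powRr1 ?(ltW mu0) //.
  by rewrite pnatr_eq0 -lt0n.
have PhiE : Phi = tail_rate r n p rho by rewrite /tail_rate rhoE.
have le_up := upper n p rho rn p0 p1 mu1 rho0 rhoE.
have le_low := lower n p rho rn p0 p1 mu1 rho0 rhoE muX.
(* Positivity makes [ln tail] a genuine logarithm rather than the default value of [ln] at 0. *)
have tail0 : 0 < tail by apply: lt_le_trans le_low; exact: expR_gt0.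
rewrite PhiE; split; rewrite -[X in _ <= X]opprK -[X in X <= _]opprK lerN2.
  by rewrite opprK -[X in _ <= X]expRK ler_ln ?posrE ?expR_gt0.
by rewrite [X in _ <= X]opprK -[X in X <= _]expRK ler_ln ?posrE ?expR_gt0.
Qed.
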